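(* Let $H:\mathfrak H_1=\mathrm{dom}(H)\subseteq\mathcal F\to\mathcal F$ be self-adjoint and bounded-from-below in the Hilbert space $\mathcal F$, and let the symmetric operator $S$ in $\mathcal F$ be $H$-small. Let $A:\mathfrak H_1\to\mathcal F$ belong to $\mathcal B(\mathfrak H_s,\mathcal F)$ for some $s\in(0,1)$ and suppose that $\mathrm{ran}(G_z)\cap\mathfrak H_1=\{0\}$ for all $z\in\varrho(H)$, where $G_z=(AR_{\bar z})^*$. Let $\lambda_\circ<\inf\sigma(H)$ be an arbitrary real number and $G:=G_{\lambda_\circ}$. Then $$H_S:\mathfrak D\subseteq\mathcal F\to\mathcal F\,,\qquad H_S:=\overline H+A^*+A_S\,,$$ $$\mathfrak D=\{\psi\in\mathcal F:\psi_\circ:=\psi-G\psi\in\mathfrak H_1\}\,,$$ $$A_S:\mathfrak D\subseteq\mathcal F\to\mathcal F\,,\qquad A_S\psi:=A\psi_\circ-T_S\psi\,,\qquad T_S:=(1-G^* )S(1-G)\,,$$ is a bounded-from-below self-adjoint operator with resolvent $$(-H_S+z)^{-1}=R_z+\mathbf G_z\big(\mathbf\Theta_S+\mathbf M_z\big)^{-1}\mathbf G_{\bar z}^*\,,\qquad z\in\varrho(H)\cap\varrho(H_S)\,,$$ where the inverse $(\mathbf\Theta_S+\mathbf M_z)^{-1}$ is understood in $\mathcal B(\mathcal F\oplus\mathfrak H_1,\mathcal F\oplus\mathfrak H_{-1})$.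
   Context: $\mathcal B(X,Y)$ denotes bounded linear operators from $X$ to $Y$; $\varrho$, $\sigma$ denote resolvent set and spectrum. A linear operator $S$ is $H$-small if $\mathrm{dom}(S)\supseteq\mathrm{dom}(H)$ and there are $a\in[0,1)$, $b\in\mathbb R$ with $\|S\psi\|\le a\|H\psi\|+b\|\psi\|$ for all $\psi\in\mathrm{dom}(H)$. For $s\in[-1,1]$, $\mathfrak H_s$ is the completion of $\mathrm{dom}(H)$ with respect to the scalar product $\langle\psi_1,\psi_2\rangle_s=\langle(H^2+1)^{s/2}\psi_1,(H^2+1)^{s/2}\psi_2\rangle$; so $\mathfrak H_0=\mathcal F$, $\mathfrak H_1=\mathrm{dom}(H)$, and $\mathfrak H_{-s}$ is identified with the (anti-)dual of $\mathfrak H_s$ via the pairing extending the scalar product of $\mathcal F$. Likewise $\mathcal F\oplus\mathfrak H_{-s}$ and $\mathcal F\oplus\mathfrak H_s$ are dual to each other. All adjoints are taken with respect to these dualities. ''$A\in\mathcal B(\mathfrak H_s,\mathcal F)$'' means that $A$ extends to a bounded operator $\mathfrak H_s\to\mathcal F$. $\overline H:\mathcal F\to\mathfrak H_{-1}$ is the bounded closure (extension) of $H:\mathfrak H_1\subseteq\mathcal F\to\mathfrak H_{-1}$, and $A^*:\mathcal F\to\mathfrak H_{-1}$ is the adjoint of $A:\mathfrak H_1\to\mathcal F$; the sum $\overline H+A^*$ is computed in $\mathfrak H_{-1}$ and takes values in $\mathcal F$ on $\mathfrak D$. For $z\in\varrho(H)$: $R_z:=(-H+z)^{-1}$, which extends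 to a bounded map $\mathfrak H_{-1}\to\mathcal F$; $G_z:=(AR_{\bar z})^*\in\mathcal B(\mathcal F)$, equivalently $G_z=R_zA^*$. One has $\mathrm{ran}(G_w-G_z)\subseteq\mathfrak H_1$. $\mathbf A:\mathfrak H_1\to\mathcal F\oplus\mathfrak H_1$, $\mathbf A\psi:=A\psi\oplus\psi$. $\mathbf G_z:=(\mathbf AR_{\bar z})^*:\mathcal F\oplus\mathfrak H_{-1}\to\mathcal F$, i.e. $\mathbf G_z(\psi\oplus\varphi)=G_z\psi+R_z\varphi$. With $R:=R_{\lambda_\circ}$ and $\mathbf G:=\mathbf G_{\lambda_\circ}$, $$\mathbf M_z:=\mathbf A(\mathbf G-\mathbf G_z)\in\mathcal B(\mathcal F\oplus\mathfrak H_{-1},\mathcal F\oplus\mathfrak H_1)\,,$$ $$\mathbf\Theta_S:=\begin{bmatrix}T_S&1-G^*\\1-G&-R\end{bmatrix}:\mathfrak D\oplus\mathcal F\subseteq\mathcal F\oplus\mathfrak H_{-1}\to\mathcal F\oplus\mathfrak H_1\,,$$ and $\mathbf\Theta_S+\mathbf M_z$ has domain $\mathfrak D\oplus\mathcal F$. *)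

(* Defs.v *)
From HB Require Import structures.
From mathcomp Require Import all_boot all_order all_algebra.
From mathcomp Require Import complex.
From mathcomp Require Import all_classical all_reals all_analysis.

Set Implicit Arguments.
Unset Strict Implicit.
Unset Printing Implicit Defensive.

Import Order.TTheory GRing.Theory Num.Theory.
Import numFieldNormedType.Exports.
Local Open Scope classical_set_scope.
Local Open Scope complex_scope.
Local Open Scope ring_scope.

(* [hdot] is linear in its first and antilinear in its second argument. *)
HB.mixin Record CompleteNormedModule_isHilbert (K : numClosedFieldType)
    (F : Type) & CompleteNormedModule K F := {
  hdot : {dot F for (@Num.conj K)} ;
  hdot_norm : forall x : F, hdot x x = `|x| ^+ 2 }.

#[short(type="hilbertType")]
HB.structure Definition Hilbert (K : numClosedFieldType) :=
  { F of CompleteNormedModule_isHilbert K F & CompleteNormedModule K F }.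

(* Values of [papp] outside [pdom] are irrelevant. *)
Record pop (U V : Type) := Pop { pdom : set U ; papp :> U -> V }.

Definition is_linop (K : numClosedFieldType) (U V : lmodType K) (T : pop U V) :=
  [/\ pdom T 0,
      forall (a : K) x y, pdom T x -> pdom T y -> pdom T (a *: x + y)
    & forall (a : K) x y, pdom T x -> pdom T y ->
        T (a *: x + y) = a *: T x + T y].

Record linop (K : numClosedFieldType) (U V : lmodType K) := LinOp {
  linop_pop :> pop U V ; linopP : is_linop linop_pop }.

Definition bounded_linear (K : numClosedFieldType) (U V : normedModType K)
    (L : U -> V) :=
  linear L /\ exists M : K, forall x, `|L x| <= M * `|x|.

Definition bounded_inverse (K : numClosedFieldType) (U V : normedModType K)
    (P : pop U V) (L : V -> U) :=
  [/\ bounded_linear L,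
      forall y, pdom P (L y) /\ P (L y) = y
    & forall x, pdom P x -> L (P x) = x].

(* [adjoint p q L] is the adjoint of [L : U -> V] for the dual pairs
   [p : U x U'] and [q : V x V'], linear in the first and antilinear in the
   second argument. *)
Definition adjoint (K : numClosedFieldType) (U V V' : Type) (U' : lmodType K)
    (p : U -> U' -> K) (q : V -> V' -> K) (L : U -> V) : V' -> U' :=
  fun y => xget 0 [set w | forall x, q (L x) y = p x w].

Section HilbertOperators.
Variables (R : realType) (F : hilbertType R[i]).
Local Notation C := R[i].
Implicit Types (T : pop F F) (z : C).

Definition adjoint_op T : pop F F :=
  Pop [set y | exists w, forall x, pdom T x -> hdot (T x) y = hdot x w]
      (fun y => xget 0 [set w | forall x, pdom T x -> hdot (T x) y = hdot x w]).

Definition self_adjoint T :=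
  [/\ is_linop T, dense (pdom T), pdom (adjoint_op T) = pdom T
    & forall x, pdom T x -> adjoint_op T x = T x].

Definition symmetric_op T :=
  forall x y, pdom T x -> pdom T y -> hdot (T x) y = hdot x (T y).

Definition bounded_below T :=
  exists c : R, forall x, pdom T x -> c%:C * `|x| ^+ 2 <= hdot (T x) x.

Definition shift_op T z : pop F F := Pop (pdom T) (fun x => - T x + z *: x).

Definition resolvent_set T : set C :=
  [set z | exists L, bounded_inverse (shift_op T z) L].

Definition spectrum T : set C := ~` resolvent_set T.

(* Meaningful for z in [resolvent_set T] only. *)
Definition resolvent T z : F -> F :=
  xget (fun=> 0) [set L | bounded_inverse (shift_op T z) L].

(* The spectrum of a self-adjoint operator is real; the infimum is +oo if it is
   empty (F = 0). *)
Definition inf_spectrum T : \bar R :=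
  ereal_inf [set x%:E | x in [set x : R | spectrum T x%:C]].

Definition small_wrt (H S : pop F F) :=
  pdom H `<=` pdom S /\
  exists a b : R, [/\ 0 <= a, a < 1 & forall x, pdom H x ->
    `|S x| <= a%:C * `|H x| + b%:C * `|x|].

End HilbertOperators.

Record pvm (R : realType) (F : hilbertType R[i]) := Pvm {
  pvm_proj :> set (measurableTypeR R) -> F -> F ;
  pvm_linear : forall B, measurable B -> linear (pvm_proj B) ;
  pvm_sym : forall B, measurable B ->
    forall x y, hdot (pvm_proj B x) y = hdot x (pvm_proj B y) ;
  pvm0 : forall x, pvm_proj set0 x = 0 ;
  pvmT : forall x, pvm_proj setT x = x ;
  pvmI : forall A B, measurable A -> measurable B ->
    forall x, pvm_proj (A `&` B) x = pvm_proj A (pvm_proj B x) ;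
  pvm_sigma : forall B : nat -> set (measurableTypeR R),
    (forall n, measurable (B n)) -> trivIset setT B ->
    forall x, series (fun n => pvm_proj (B n) x) @ \oo
                --> pvm_proj (\bigcup_n B n) x }.

Section SpectralMeasure.
Variables (R : realType) (F : hilbertType R[i]) (E : pvm F) (x : F).

(* B |-> <E(B) x, x> = |E(B) x|^2 *)
Definition spectral_measure (B : set (measurableTypeR R)) : \bar R :=
  (complex.Re (`|E B x| ^+ 2))%:E.

Let RCle (a b : R) : (a%:C <= b%:C) = (a <= b).
Proof. by rewrite lecE /= eqxx. Qed.

Let Re_norm (V : normedModType R[i]) (v : V) : (complex.Re `|v|)%:C = `|v|.
Proof. by rewrite RRe_real// ger0_real. Qed.

Let Re_norm2 (v : F) : complex.Re (`|v| ^+ 2) = complex.Re `|v| ^+ 2.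
Proof.
by apply: complexI; rewrite rmorphXn/= Re_norm RRe_real// ger0_real// exprn_ge0.
Qed.

Let sm0 : spectral_measure set0 = 0%E.
Proof. by rewrite /spectral_measure pvm0 normr0 expr0n. Qed.

Let sm_ge0 B : (0 <= spectral_measure B)%E.
Proof. by rewrite lee_fin Re_norm2 sqr_ge0. Qed.

Let sm_pythagoras (B : nat -> set (measurableTypeR R)) :
  (forall n, measurable (B n)) -> trivIset setT B ->
  forall n, `|series (fun k => E (B k) x) n| ^+ 2 =
    \sum_(0 <= k < n) `|E (B k) x| ^+ 2.
Proof.
move=> mB tB n.
have orth i j : i != j -> hdot (E (B i) x) (E (B j) x) = 0.
  move=> ij; rewrite pvm_sym// -pvmI//.
  move/trivIsetP : tB => /(_ i j Logic.I Logic.I ij) ->.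
  by rewrite pvm0 linear0r.
elim: n => [|n IH].
  by rewrite /series/= !big_geq// normr0 expr0n.
rewrite seriesSr big_nat_recr//= -IH -!hdot_norm.
have h0 : hdot (series (fun k => E (B k) x) n) (E (B n) x) = 0.
  rewrite /series/= linear_sumlz big_nat big1// => k /andP[_ kn].
  by apply: orth; rewrite ltn_eqF.
by rewrite hnormDd.
Qed.

Let sm_sigma : semi_sigma_additive spectral_measure.
Proof.
move=> B mB tB _; rewrite /spectral_measure.
under eq_fun do rewrite sumEFin.
apply: cvg_EFin; first by near=> n.
rewrite [X in X @ _ --> _](_ : _ =
    (fun n => complex.Re `|series (fun k => E (B k) x) n| ^+ 2)); last first.
  apply/funext => n /=; rewrite -Re_norm2 sm_pythagoras//.
  by rewrite raddf_sum.
have hE : series (fun n => E (B n) x) @ \oo --> E (\bigcup_n B n) x.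
  exact: pvm_sigma.
have hn : complex.Re `|series (fun n => E (B n) x) n| @[n --> \oo] -->
    complex.Re `|E (\bigcup_n B n) x|.
  apply/cvgrPdist_le => e e0.
  have eC : 0 < e%:C :> R[i] by rewrite ltcR.
  move/cvgrPdist_le : hE => /(_ _ eC); apply: filterS => n /= hnE.
  rewrite -RCle -raddfB /= (le_trans (normc_ge_Re _))// (le_trans _ hnE)//.
  exact: ler_dist_dist.
by rewrite Re_norm2 expr2; under eq_fun do rewrite expr2; exact: cvgM.
Unshelve. all: by end_near. Qed.

HB.instance Definition _ := isMeasure.Build _ _ _ spectral_measure
  sm0 sm_ge0 sm_sigma.

End SpectralMeasure.

Section FunctionalCalculus.
Variables (R : realType) (F : hilbertType R[i]).

(* T is the integral of f with respect to the projection-valued measure E. As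
   T is linear, it is determined by [si_dom] and [si_form]; [si_norm] is the
   usual accompanying identity. *)
Record spectral_integral (E : pvm F) (f : R -> R) (T : linop F F) : Prop := {
  si_dom : pdom T =
    [set x | (\int[spectral_measure E x]_t ((f t) ^+ 2)%:E < +oo)%E] ;
  si_form : forall x, pdom T x ->
    hdot (T x) x = (\int[spectral_measure E x]_t f t)%R%:C ;
  si_norm : forall x, pdom T x ->
    `|T x| ^+ 2 = (\int[spectral_measure E x]_t (f t) ^+ 2)%R%:C }.

(* T = f(H) for a Borel function f. The projection-valued measure of a
   self-adjoint H exists and is unique by the spectral theorem. *)
Definition functional_calculus (H : linop F F) (f : R -> R) (T : linop F F) :=
  exists E : pvm F, spectral_integral E (fun t => t) H /\
                    spectral_integral E f T.

End FunctionalCalculus.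

(* H_1 = dom(H), whose norm |(H^2 + 1)^(1/2) x| is the graph norm. *)
Section DomainSpace.
Variables (R : realType) (F : hilbertType R[i]) (H : linop F F).
Local Notation C := R[i].

Definition in_pdom : {pred F} := fun x => x \in pdom H.

Fact in_pdom_submod_closed : submod_closed in_pdom.
Proof.
have [H0 HD _] := linopP H; split; first exact: mem_set.
by move=> a x y /set_mem Hx /set_mem Hy; apply: mem_set; exact: HD.
Qed.

HB.instance Definition _ :=
  GRing.isSubmodClosed.Build C F in_pdom in_pdom_submod_closed.

Record domain_space := DomainSpace {
  dval : F ; dvalP : dval \in in_pdom }.

HB.instance Definition _ := [isSub for dval].
HB.instance Definition _ := [Choice of domain_space by <:].
HB.instance Definition _ := [SubChoice_isSubLmodule of domain_space by <:].

Lemma dval0 : dval 0 = 0.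
Proof. exact: (raddf0 (val : domain_space -> F)). Qed.

Lemma dvalD x y : dval (x + y) = dval x + dval y.
Proof. exact: (raddfD (val : domain_space -> F)). Qed.

Lemma dvalZ (a : C) x : dval (a *: x) = a *: dval x.
Proof. exact: GRing.valZ. Qed.

Lemma pdom_dval x : pdom H (dval x).
Proof. exact/set_mem/dvalP. Qed.

Definition domain_norm (x : domain_space) : C :=
  sqrtC (`|dval x| ^+ 2 + `|H (dval x)| ^+ 2).

Let HP (a : C) (x y : domain_space) :
  H (a *: dval x + dval y) = a *: H (dval x) + H (dval y).
Proof. by have [_ _] := linopP H; apply; exact: pdom_dval. Qed.

Let HD (x y : domain_space) : H (dval x + dval y) = H (dval x) + H (dval y).
Proof. by have := HP 1 x y; rewrite !scale1r. Qed.

Let HZ (a : C) (x : domain_space) : H (a *: dval x) = a *: H (dval x).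
Proof.
have H0 : H 0 = 0.
  have := HP (-1) 0 0; rewrite dval0 scaler0 addr0 scaleN1r addNr.
  by [].
by have := HP a x 0; rewrite dval0 addr0 H0 addr0.
Qed.

Let rect_norm (a b : C) : 0 <= a -> 0 <= b ->
  sqrtC (a ^+ 2 + b ^+ 2) = `|a + 'i * b|.
Proof.
by move=> a0 b0; rewrite -normC2_rect ?ger0_real// sqrCK.
Qed.

Let domain_normD x y : domain_norm (x + y) <= domain_norm x + domain_norm y.
Proof.
rewrite /domain_norm.
apply: (@le_trans _ _ (sqrtC ((`|dval x| + `|dval y|) ^+ 2 +
    (`|H (dval x)| + `|H (dval y)|) ^+ 2))).
  rewrite ler_sqrtC ?qualifE/= ?addr_ge0 ?exprn_ge0 ?addr_ge0//.
  rewrite HD.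
  by rewrite lerD// lerXn2r ?nnegrE ?addr_ge0// ler_normD.
rewrite !rect_norm ?addr_ge0//.
by rewrite (le_trans _ (ler_normD _ _))// mulrDr addrACA.
Qed.

Let domain_normZ (a : C) x : domain_norm (a *: x) = `|a| * domain_norm x.
Proof.
rewrite /domain_norm dvalZ HZ !normrZ.
by rewrite !exprMn -mulrDr sqrtCM ?qualifE/= ?addr_ge0 ?exprn_ge0// sqrCK.
Qed.

Let domain_norm0 x : domain_norm x = 0 -> x = 0.
Proof.
move/eqP; rewrite sqrtC_eq0 paddr_eq0 ?exprn_ge0//.
rewrite expf_eq0/= normr_eq0 => /andP[/eqP x0 _].
by apply: val_inj; rewrite /= x0.
Qed.

HB.instance Definition _ := @Lmodule_isNormed.Build C domain_space
  domain_norm domain_normD domain_normZ domain_norm0.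

End DomainSpace.

(* Bounded antilinear functionals with the dual norm; for V = H_1 this is
   H_{-1}. *)
Section Antidual.
Variables (R : realType) (V : normedModType R[i]).
Local Notation C := R[i].

Definition is_antidual : {pred V -> C} := fun l =>
  `[< (forall (a : C) x y, l (a *: x + y) = a^* * l x + l y) /\
      exists M : C, forall x, `|l x| <= M * `|x| >].

Fact is_antidual_submod_closed : submod_closed is_antidual.
Proof.
split.
  apply/asboolP; split => [a x y|]; first by rewrite /= mulr0 addr0.
  by exists 0 => x; rewrite /= normr0 mul0r.
move=> a l m /asboolP[lP [M lM]] /asboolP[mP [N mN]].
have E x : (a *: l + m) x = a * l x + m x by [].
apply/asboolP; split.
  move=> b x y; rewrite !E lP mP !mulrDr addrACA.
  by rewrite -!addrA; congr (_ + _); rewrite mulrCA.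
exists (`|a| * M + N) => x.
rewrite E (le_trans (ler_normD _ _))// mulrDl lerD// normrM -mulrA.
by rewrite ler_wpM2l.
Qed.

HB.instance Definition _ :=
  GRing.isSubmodClosed.Build C (V -> C) is_antidual is_antidual_submod_closed.

Record antidual := Antidual {
  aval :> V -> C ; avalP : aval \in is_antidual }.

HB.instance Definition _ := [isSub for aval].
HB.instance Definition _ := [Choice of antidual by <:].
HB.instance Definition _ := [SubChoice_isSubLmodule of antidual by <:].

Definition antidual_norm (l : antidual) : C :=
  (sup [set complex.Re `|l x| | x in [set x | `|x| <= 1]])%:C.

Implicit Types (l m : antidual) (x : V).

Let unit_vals l :=
  [set complex.Re `|l x| | x in [set x | `|x| <= 1]].

Let Re_norm (v : C) : (complex.Re `|v|)%:C = `|v|.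
Proof. by rewrite RRe_real// ger0_real. Qed.

Let aP (l : antidual) (a : C) x y : l (a *: x + y) = a^* * l x + l y.
Proof. by have /asboolP[] := avalP l. Qed.

Let a0 (l : antidual) : l 0 = 0.
Proof.
have := aP l (-1) 0 0; rewrite scaler0 addr0 rmorphN1 mulN1r => ->.
by rewrite addNr.
Qed.

Let aZ (l : antidual) (a : C) x : l (a *: x) = a^* * l x.
Proof. by have := aP l a x 0; rewrite a0 !addr0. Qed.

Let RCle (a b : R) : (a%:C <= b%:C) = (a <= b).
Proof. by rewrite lecE /= eqxx. Qed.

Let unit_vals_sup l : has_sup (unit_vals l).
Proof.
split; first by exists (complex.Re `|l 0|), 0 => //=; rewrite normr0.
have /asboolP[_ [M lM]] := avalP l.
exists (complex.Re `|M|) => _ [x /= x1 <-].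
rewrite -RCle !Re_norm.
have [Mx0|] := boolP (0 <= M * `|x|); last first.
  by move/negP; case; exact: le_trans (lM x).
by rewrite (le_trans (lM x))// -(ger0_norm Mx0) normrM normr_id ler_piMr.
Qed.

Let sup_ub l x : `|x| <= 1 -> `|l x| <= antidual_norm l.
Proof.
move=> x1; rewrite /antidual_norm -Re_norm RCle.
by apply: ub_le_sup; [exact: (unit_vals_sup l).2|exists x].
Qed.

Let le_antidual_norm l (M : R) :
  (forall x, `|x| <= 1 -> `|l x| <= M%:C) -> antidual_norm l <= M%:C.
Proof.
move=> lM; rewrite /antidual_norm RCle.
apply: ge_sup; first exact: (unit_vals_sup l).1.
by move=> _ [x /= x1 <-]; rewrite -RCle Re_norm lM.
Qed.

Lemma antidual_normP l x : `|l x| <= antidual_norm l * `|x|.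
Proof.
have [->|x0] := eqVneq x 0; first by rewrite a0 !normr0 mulr0.
have nx : 0 < `|x| by rewrite normr_gt0.
rewrite -ler_pdivrMr// -[leLHS](_ : `|l (`|x|^-1 *: x)| = _).
  by apply: sup_ub; rewrite normrZ normfV normr_id mulVf ?gt_eqF.
by rewrite aZ normrM norm_conjC normfV normr_id mulrC.
Qed.

Let antidual_normD l m :
  antidual_norm (l + m) <= antidual_norm l + antidual_norm m.
Proof.
rewrite {2 3}/antidual_norm -rmorphD; apply: le_antidual_norm => x x1.
rewrite (_ : (l + m) x = l x + m x)//.
by rewrite rmorphD (le_trans (ler_normD _ _))// lerD// sup_ub.
Qed.

Let antidual_normZ_le (a : C) l :
  antidual_norm (a *: l) <= `|a| * antidual_norm l.
Proof.
rewrite {2}/antidual_norm -Re_norm -rmorphM; apply: le_antidual_norm => x x1.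
rewrite (_ : (a *: l) x = a * l x)//.
by rewrite normrM rmorphM/= Re_norm ler_wpM2l// sup_ub.
Qed.

Let antidual_normZ (a : C) l :
  antidual_norm (a *: l) = `|a| * antidual_norm l.
Proof.
apply/eqP; rewrite eq_le antidual_normZ_le/=.
have [->|a_neq0] := eqVneq a 0.
  rewrite normr0 mul0r (le_trans _ (@sup_ub (0 *: l) 0 _)) ?normr0//.
have /= := antidual_normZ_le a^-1 (a *: l).
rewrite scalerA mulVf// scale1r normfV => h.
by rewrite mulrC -ler_pdivlMr ?normr_gt0// mulrC.
Qed.

Let antidual_norm0 l : antidual_norm l = 0 -> l = 0.
Proof.
move=> l0; apply: val_inj; apply/funext => x /=.
by apply/eqP; rewrite -normr_le0 (le_trans (antidual_normP l x))// l0 mul0r.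
Qed.

HB.instance Definition _ := @Lmodule_isNormed.Build C antidual
  antidual_norm antidual_normD antidual_normZ antidual_norm0.

End Antidual.

Section Construction.
Variables (R : realType) (F : hilbertType R[i]).
Variables (H S : linop F F) (A : {linear domain_space H -> F}).
Variable lambda0 : R.
Local Notation C := R[i].
Local Notation H1 := (domain_space H).
Local Notation Hm1 := (antidual (domain_space H)).
Implicit Types (z : C).

(* A extends to a bounded operator on the completion H_s of dom(H) with respect
   to |x|_s = |(H^2 + 1)^(s/2) x|. *)
Definition bounded_on_Hs (s : R) :=
  exists T : linop F F,
    functional_calculus H (fun t => (t ^+ 2 + 1) `^ (s / 2)) T /\
    exists M : C, forall x : H1, `|A x| <= M * `|T (dval x)|.

(* The inverse of [dval] on dom(H), with value 0 elsewhere. *)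
Definition to_H1 (x : F) : H1 := insubd (0 : H1) x.

(* The pairings of H_1 and H_{-1} extending the scalar product of F, which is
   embedded in H_{-1} by x |-> <x, .>. *)
Definition pair_1_m1 (x : H1) (l : Hm1) : C := (l x)^*.
Definition pair_m1_1 (l : Hm1) (x : H1) : C := l x.

Definition pair_sum (U U' V V' : Type) (p : U -> U' -> C) (q : V -> V' -> C)
    (x : U * V) (y : U' * V') : C := p x.1 y.1 + q x.2 y.2.

Definition to_Hm1 (x : F) : Hm1 :=
  insubd (0 : Hm1) (fun y : H1 => hdot x (dval y)).

(* The inverse of [to_Hm1] on its range, with value 0 elsewhere. *)
Definition of_Hm1 (l : Hm1) : F := xget 0 [set x | to_Hm1 x = l].

(* The bounded extension F -> H_{-1} of H : H_1 -> F. *)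
Definition Hbar : F -> Hm1 :=
  xget (fun=> 0) [set L | bounded_linear L /\
    forall x : H1, L (dval x) = to_Hm1 (H (dval x))].

Definition A_adj : F -> Hm1 := adjoint pair_1_m1 (@hdot _ F) A.

Definition Rz z : F -> F := resolvent H z.

Definition Gz z : F -> F :=
  adjoint (@hdot _ F) (@hdot _ F) (fun x => A (to_H1 (Rz z^* x))).

Definition bfA (x : H1) : F * H1 := (A x, x).

Definition bfG z : F * Hm1 -> F :=
  adjoint (@hdot _ F) (pair_sum (@hdot _ F) pair_1_m1)
    (fun x => bfA (to_H1 (Rz z^* x))).

Definition bfG_adj z : F -> F * H1 :=
  adjoint (pair_sum (@hdot _ F) pair_m1_1) (@hdot _ F) (bfG z).

Local Notation R0 := (Rz lambda0%:C).
Local Notation G := (Gz lambda0%:C).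
Definition G_adj : F -> F := adjoint (@hdot _ F) (@hdot _ F) G.

Definition bfM z (p : F * Hm1) : F * H1 :=
  bfA (to_H1 (bfG lambda0%:C p - bfG z p)).

Definition domD : set F := [set x | pdom H (x - G x)].

Definition T_S (x : F) : F := S (x - G x) - G_adj (S (x - G x)).

Definition A_S (x : F) : F := A (to_H1 (x - G x)) - T_S x.

(* [Hbar x + A_adj x] is computed in H_{-1} and lies in F for x in [domD]. *)
Definition H_S : pop F F :=
  Pop domD (fun x => of_Hm1 (Hbar x + A_adj x) + A_S x).

Definition Theta_S : pop (F * Hm1) (F * H1) :=
  Pop [set p | domD p.1 /\ range to_Hm1 p.2]
      (fun p => let x := p.1 in let y := of_Hm1 p.2 in
        (T_S x + (y - G_adj y), to_H1 (x - G x) - to_H1 (R0 y))).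

Definition Theta_M z : pop (F * Hm1) (F * H1) :=
  Pop (pdom Theta_S) (fun p => Theta_S p + bfM z p).

End Construction.

(* Main.v *)
(* Since A = G^* (l - H) on dom(H) for l = lambda0, testing H_S against vectors
   of F gives
       H_S = l + (1 - G^* ) (H - l - S) (1 - G)
   on the preimage of dom(H) under 1 - G. If l is replaced by a very negative m,
   then |G_m| < 1, because A is infinitesimally H-bounded: (t^2 + 1)^s <=
   e t^2 + K as s < 1. By Kato and Rellich H - m - S is then symmetric, surjective and
   nonnegative, so that the right-hand side minus m is symmetric and surjective,
   hence self-adjoint. As G_m - G_l = (l - m) R_m G_l maps into dom(H), the
   operators for l and m have the same domain and differ by a bounded operator.

   For the resolvent formula, H (x - G_z x) + z G_z x = Hbar x + A^* x for every
   z; therefore (Theta_S + M_z) (x, y) = (f, g) is solved by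
   x = (-H_S + z)^-1 (f + (-H + z) g - A g) and y = (-H + z) (x - G_z x - g). *)

Require Import Defs.
From mathcomp Require Import all_boot all_order all_algebra.
From mathcomp Require Import complex.
From mathcomp Require Import all_classical all_reals all_analysis.
From mathcomp Require Import measurable_realfun ring lra.
Import Order.TTheory GRing.Theory Num.Theory.
Import numFieldNormedType.Exports.
Local Open Scope classical_set_scope.
Local Open Scope complex_scope.
Local Open Scope ring_scope.
Set Implicit Arguments.
Unset Strict Implicit.
Unset Printing Implicit Defensive.

(** * Norms, bounded operators and scalar products *)

(** The way back is delicate because [T_S] holds the unbounded [S] between two factors that both
    change with the energy; symmetry of [S] moves it onto the difference of these factors, and only
    bounded terms remain. Nonnegativity of [H - m - S] requires passing from the norm bound
    [|S x| <= q |(H - m) x|] to a form bound with the same [q]. This is achieved without square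
    roots of operators, by iterating [(H - m)^-1 S]. The functional calculus enters through one
    scalar inequality integrated against the spectral measure. Identities in H_{-1} are tested
    against dom(H), identities in F against all of F. [adjoint] and [Hbar] are choices with a
    default value, so each is characterized by such a tested identity before use. *)

Section RealNorm.
Variable R : realType.
Local Notation C := R[i].

(** The norm takes values in [C], whose order is only partial; its real part brings estimates into a
    total order, where [lra] applies. *)
Definition nrm (V : normedModType C) (x : V) : R := complex.Re `|x|.

Lemma real_complexM (a b : R) : (a * b)%:C = a%:C * b%:C :> C.
Proof. exact: rmorphM. Qed.

Lemma real_complexD (a b : R) : (a + b)%:C = a%:C + b%:C :> C.
Proof. exact: rmorphD. Qed.

Lemma conj_real_complex (a : R) : (a%:C : C)^* = a%:C.
Proof. by rewrite conj_Creal// complex_real. Qed.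

Lemma conjM (a b : C) : (a * b)^* = a^* * b^*.
Proof. exact: rmorphM. Qed.

Lemma conjD (a b : C) : (a + b)^* = a^* + b^*.
Proof. exact: rmorphD. Qed.

Lemma conjN (a : C) : (- a)^* = - a^*.
Proof. exact: rmorphN. Qed.

Lemma conj_eq_real (c : C) : c^* = c -> c = (complex.Re c)%:C.
Proof. by move=> cc; rewrite RRe_real//; apply/CrealP. Qed.

Lemma ReJ (c : C) : complex.Re (c^*)%R = complex.Re c.
Proof. by case: c. Qed.

Definition cnrm (a : C) : R := complex.Re `|a|.

Lemma cnrmE (a : C) : `|a| = (cnrm a)%:C.
Proof. by rewrite /cnrm RRe_real// ger0_real. Qed.

Lemma ReZ (a : R) (z : C) : complex.Re (a%:C * z) = a * complex.Re z.
Proof. by case: z => za zb /=; rewrite mul0r subr0. Qed.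

Lemma ReD (x y : C) : complex.Re (x + y) = complex.Re x + complex.Re y.
Proof. exact: raddfD. Qed.

Lemma ReN (x : C) : complex.Re (- x) = - complex.Re x.
Proof. exact: raddfN. Qed.

Variable V : normedModType C.
Implicit Types x y : V.

Lemma nrmE x : `|x| = (nrm x)%:C.
Proof. by rewrite /nrm RRe_real// ger0_real. Qed.

Lemma nrm_ge0 x : 0 <= nrm x.
Proof. by rewrite -lecR -nrmE; exact: normr_ge0. Qed.

Lemma nrm0 : nrm (0 : V) = 0.
Proof. by rewrite /nrm normr0. Qed.

Lemma nrm_eq0 x : nrm x = 0 -> x = 0.
Proof. by move=> x0; apply/normr0_eq0; rewrite nrmE x0. Qed.

Lemma nrm_le0 x : nrm x <= 0 -> x = 0.
Proof. by move=> x0; apply: nrm_eq0; apply/eqP; rewrite eq_le x0 nrm_ge0. Qed.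

Lemma nrmN x : nrm (- x) = nrm x.
Proof. by rewrite /nrm normrN. Qed.

Lemma nrmBC x y : nrm (x - y) = nrm (y - x).
Proof. by rewrite -nrmN opprB. Qed.

Lemma nrmD x y : nrm (x + y) <= nrm x + nrm y.
Proof. by rewrite -lecR real_complexD -!nrmE ler_normD. Qed.

Lemma nrmB x y : nrm (x - y) <= nrm x + nrm y.
Proof. by rewrite -(nrmN y) nrmD. Qed.

Lemma nrm_tri x y z : nrm (x - z) <= nrm (x - y) + nrm (y - z).
Proof. by rewrite -[x - z](subrKA y) nrmD. Qed.

Lemma nrmZ (a : C) x : nrm (a *: x) = cnrm a * nrm x.
Proof.
by apply: (@complexI R); rewrite real_complexM -!nrmE -cnrmE; exact: normrZ.
Qed.

End RealNorm.

Section ScalarNorm.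
Variable R : realType.
Local Notation C := R[i].
Implicit Types a b : C.

Lemma cnrm_ge0 a : 0 <= cnrm a.
Proof. by rewrite -lecR -cnrmE; exact: normr_ge0. Qed.

Lemma cnrm0 : cnrm (0 : C) = 0.
Proof. by rewrite /cnrm normr0. Qed.

Lemma cnrmM a b : cnrm (a * b) = cnrm a * cnrm b.
Proof.
by apply: (@complexI R); rewrite real_complexM -!cnrmE normrM.
Qed.

Lemma cnrmD a b : cnrm (a + b) <= cnrm a + cnrm b.
Proof. by rewrite -lecR real_complexD -!cnrmE ler_normD. Qed.

Lemma cnrmJ a : cnrm a^* = cnrm a.
Proof. by rewrite /cnrm norm_conjC. Qed.

Lemma cnrmR (r : R) : cnrm r%:C = `|r|.
Proof. by rewrite /cnrm normc_def/= expr0n addr0 sqrtr_sqr. Qed.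

Lemma Re_le_cnrm a : `|complex.Re a| <= cnrm a.
Proof. by rewrite -lecR -cnrmE normc_ge_Re. Qed.

End ScalarNorm.

Section BoundedLinear.
Variables (R : realType) (U V : normedModType R[i]).
Local Notation C := R[i].

Lemma bounded_linearP (L : U -> V) : bounded_linear L <->
  linear L /\ exists2 M : R, 0 <= M & forall x, nrm (L x) <= M * nrm x.
Proof.
split=> -[lL [M]].
  move=> bL; split=> //; exists (cnrm M); first exact: cnrm_ge0.
  move=> x; rewrite -lecR real_complexM -!nrmE -cnrmE.
  (* [M] is any complex number; lying above [|L x|], the product [M * |x|] is nonnegative, so it
     equals its modulus [|M| * |x|]. *)
  have Mx0 : 0 <= M * `|x| by exact: le_trans (bL x).
  by rewrite (le_trans (bL x))// -(ger0_norm Mx0) normrM normr_id.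
move=> M0 bL; split=> //; exists M%:C => x.
by rewrite !nrmE -real_complexM lecR.
Qed.

Lemma linear_addl (L : U -> V) : linear L -> {morph L : x y / x + y}.
Proof. by move=> lL x y; rewrite -[x]scale1r lL !scale1r. Qed.

Lemma linear_zero (L : U -> V) : linear L -> L 0 = 0.
Proof.
by move=> lL; have := lL (-1) 0 0; rewrite scaler0 addr0 scaleN1r addNr.
Qed.

Lemma linear_scale (L : U -> V) a x : linear L -> L (a *: x) = a *: L x.
Proof. by move=> lL; rewrite -[a *: x]addr0 lL linear_zero// addr0. Qed.

Lemma linear_opp (L : U -> V) x : linear L -> L (- x) = - L x.
Proof. by move=> lL; rewrite -scaleN1r linear_scale// scaleN1r. Qed.

Lemma linear_sub (L : U -> V) : linear L -> {morph L : x y / x - y}.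
Proof. by move=> lL x y; rewrite linear_addl// linear_opp. Qed.

Lemma bounded_add (K L : U -> V) :
  bounded_linear K -> bounded_linear L -> bounded_linear (fun x => K x + L x).
Proof.
move=> /bounded_linearP[lK [M M0 bK]] /bounded_linearP[lL [N N0 bL]].
apply/bounded_linearP; split=> [a x y|].
  by rewrite lL lK scalerDr addrACA.
exists (M + N) => [|x]; first exact: addr_ge0.
by rewrite (le_trans (nrmD _ _))// mulrDl lerD.
Qed.

Lemma bounded_scale (a : C) (L : U -> V) :
  bounded_linear L -> bounded_linear (fun x => a *: L x).
Proof.
move=> /bounded_linearP[lL [N N0 bL]].
apply/bounded_linearP; split=> [b x y|].
  by rewrite lL scalerDr !scalerA mulrC.
exists (cnrm a * N) => [|x]; first by rewrite mulr_ge0// cnrm_ge0.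
by rewrite nrmZ -mulrA ler_wpM2l// cnrm_ge0.
Qed.

Lemma bounded_opp (L : U -> V) :
  bounded_linear L -> bounded_linear (fun x => - L x).
Proof.
move=> /(bounded_scale (-1)); congr bounded_linear.
by apply/funext => x; rewrite scaleN1r.
Qed.

Lemma bounded_sub (K L : U -> V) :
  bounded_linear K -> bounded_linear L -> bounded_linear (fun x => K x - L x).
Proof. by move=> bK bL; exact: bounded_add bK (bounded_opp bL). Qed.

End BoundedLinear.

Lemma bounded_comp (R : realType) (U V W : normedModType R[i])
    (K : V -> W) (L : U -> V) :
  bounded_linear K -> bounded_linear L -> bounded_linear (fun x => K (L x)).
Proof.
move=> /bounded_linearP[lK [M M0 bK]] /bounded_linearP[lL [N N0 bL]].
apply/bounded_linearP; split=> [a x y|]; first by rewrite lL lK.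
exists (M * N) => [|x]; first exact: mulr_ge0.
by rewrite (le_trans (bK _))// -mulrA ler_wpM2l.
Qed.


Lemma bounded_id (R : realType) (U : normedModType R[i]) :
  bounded_linear (fun x : U => x).
Proof.
by apply/bounded_linearP; split=> //; exists 1 => // x; rewrite mul1r.
Qed.

Section InnerProduct.
Variables (R : realType) (F : hilbertType R[i]).
Local Notation C := R[i].
Implicit Types (x y w : F) (a : C).

Lemma hdotDl x y w : hdot (x + y) w = hdot x w + hdot y w :> C.
Proof. exact: linearDl. Qed.
Lemma hdotDr w x y : hdot w (x + y) = hdot w x + hdot w y :> C.
Proof. exact: linearDr. Qed.
Lemma hdotNl x w : hdot (- x) w = - hdot x w :> C.
Proof. exact: linearNl. Qed.
Lemma hdotNr w x : hdot w (- x) = - hdot w x :> C.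
Proof. exact: linearNr. Qed.
Lemma hdotZl a x w : hdot (a *: x) w = a * hdot x w :> C.
Proof. exact: linearZl_LR. Qed.
Lemma hdotZr a w x : hdot w (a *: x) = a^* * hdot w x :> C.
Proof. exact: linearZr_LR. Qed.
Lemma hdot0l w : hdot 0 w = 0 :> C.
Proof. exact: linear0l. Qed.
Lemma hdot0r w : hdot w 0 = 0 :> C.
Proof. exact: linear0r. Qed.
Definition hdotE := (hdotDl, hdotDr, hdotNl, hdotNr, hdotZl, hdotZr).

Lemma hdotC x y : hdot x y = (hdot y x)^* :> C.
Proof. by rewrite (hermC (@hdot _ F) x y) expr0 mul1r. Qed.

Lemma hdotxx x : hdot x x = (nrm x ^+ 2)%:C :> C.
Proof. by rewrite hdot_norm nrmE -rmorphXn. Qed.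

Lemma nrm2 x : nrm x ^+ 2 = complex.Re (hdot x x).
Proof. by rewrite hdotxx. Qed.

Lemma hdot_eq0 x : hdot x x = 0 -> x = 0.
Proof.
rewrite hdotxx => /complexI/eqP; rewrite expf_eq0/= => /eqP.
exact: nrm_eq0.
Qed.

Lemma hdot_inj x y : (forall w, hdot w x = hdot w y) -> x = y.
Proof.
move=> xy; apply/eqP; rewrite -subr_eq0; apply/eqP/hdot_eq0.
by rewrite hdotDr hdotNr xy subrr.
Qed.

Lemma nrm2D x y :
  nrm (x + y) ^+ 2 = nrm x ^+ 2 + nrm y ^+ 2 + 2 * complex.Re (hdot x y).
Proof.
rewrite !nrm2 !hdotE (hdotC y x) !ReD ReJ.
by lra.
Qed.

Lemma nrm2B x y :
  nrm (x - y) ^+ 2 = nrm x ^+ 2 + nrm y ^+ 2 - 2 * complex.Re (hdot x y).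
Proof. by rewrite nrm2D nrmN hdotNr ReN mulrN. Qed.

Lemma cauchy_schwarz x y : cnrm (hdot x y) <= nrm x * nrm y.
Proof.
have [->|y0] := eqVneq y 0; first by rewrite hdot0r nrm0 mulr0 cnrm0.
have ny : 0 < nrm y.
  by rewrite lt_def nrm_ge0 andbT; apply: contra_neq y0 => /nrm_eq0.
(* The vector is [|y|^2] times the component of [x] orthogonal to [y]; this scaling avoids a
   division. *)
have := sqr_ge0 (nrm ((nrm y ^+ 2)%:C *: x - hdot x y *: y)).
rewrite nrm2B !nrmZ hdotZl hdotZr.
rewrite (_ : cnrm (nrm y ^+ 2)%:C = nrm y ^+ 2); last first.
  by rewrite cnrmR ger0_norm// sqr_ge0.
have -> : complex.Re ((nrm y ^+ 2)%:C * ((hdot x y)^* * hdot x y)) =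
    nrm y ^+ 2 * cnrm (hdot x y) ^+ 2.
  rewrite mulrC [_^* * _]mulrC -normCK cnrmE -rmorphXn -real_complexM/=.
  by rewrite mulrC.
move=> h.
rewrite -ler_sqr ?nnegrE ?mulr_ge0 ?nrm_ge0 ?cnrm_ge0//.
rewrite -(ler_pM2l (exprn_gt0 2 ny)).
by move: h; rewrite exprMn; lra.
Qed.

Lemma Re_hdot_le x y : complex.Re (hdot x y) <= nrm x * nrm y.
Proof.
rewrite (le_trans _ (cauchy_schwarz x y))//.
by rewrite (le_trans _ (Re_le_cnrm _))// ler_norm.
Qed.

End InnerProduct.

(** * Orthogonal projection and the Riesz representation *)

Section Convergence.
Variables (R : realType) (F : hilbertType R[i]).
Local Notation C := R[i].
Implicit Types (u : nat -> F) (l x y : F).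

Definition tends u l :=
  forall e : R, 0 < e -> exists N, forall n, (N <= n)%N -> nrm (u n - l) < e.

Definition seq_closed (M : set F) :=
  forall u l, (forall n, M (u n)) -> tends u l -> M l.

Definition subspace (M : set F) :=
  M 0 /\ forall (a : C) x y, M x -> M y -> M (a *: x + y).

Lemma inv_nat_lt (e : R) : 0 < e ->
  exists N, forall n, (N <= n)%N -> n.+1%:R^-1 < e.
Proof.
move=> e0; exists (Num.bound e^-1) => n Nn.
rewrite -[e]invrK ltf_pV2 ?posrE ?invr_gt0// (lt_le_trans (archi_boundP _))//.
  by rewrite invr_ge0 ltW.
by rewrite ler_nat (leq_trans Nn).
Qed.

Lemma cauchy_tends u :
  (forall e : R, 0 < e -> exists N, forall m n, (N <= m)%N -> (N <= n)%N ->
     nrm (u m - u n) < e) ->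
  exists l, tends u l.
Proof.
move=> cu.
have: cvg (u @ \oo).
  apply/cauchy_cvgP/cauchy_exP => e e0.
  have eE : e = (complex.Re e)%:C by rewrite RRe_real// gtr0_real.
  have [|N NP] := cu (complex.Re e); first by rewrite -ltcR -eE.
  exists (u N); exists N => // n /= Nn.
  by rewrite -ball_normE/= nrmE eE ltcR NP.
move=> cvu; exists (lim (u @ \oo)) => e e0.
have e0C : 0 < e%:C :> C by rewrite ltcR.
move/cvgrPdist_lt : cvu => /(_ _ e0C)[N _ NP].
by exists N => n Nn; have := NP n Nn; rewrite /= distrC nrmE ltcR.
Qed.

Lemma tends_unique u l l' : tends u l -> tends u l' -> l = l'.
Proof.
move=> ul ul'; apply/eqP; rewrite -subr_eq0; apply/eqP/nrm_le0.
apply/ler_addgt0Pr => e e0; rewrite add0r.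
have e2 : 0 < e / 2 by lra.
have [N NP] := ul _ e2; have [N' NP'] := ul' _ e2.
have := NP _ (leq_maxl N N'); have := NP' _ (leq_maxr N N').
have := nrm_tri l (u (maxn N N')) l'; rewrite (nrmBC l (u _)).
lra.
Qed.

Lemma tends_bounded (L : F -> F) u l :
  bounded_linear L -> tends u l -> tends (fun n => L (u n)) (L l).
Proof.
move=> /bounded_linearP[lL [M M0 LM]] ul e e0.
have [|N NP] := ul (e / (M + 1)); first by rewrite divr_gt0// ltr_pwDr.
exists N => n Nn; rewrite -linear_sub//.
have M1 : 0 < M + 1 by lra.
have := NP n Nn; rewrite ltr_pdivlMr// => h.
have := LM (u n - l); have := nrm_ge0 (u n - l).
by move: h; lra.
Qed.

Lemma parallelogram x y :
  nrm (x + y) ^+ 2 + nrm (x - y) ^+ 2 = 2 * nrm x ^+ 2 + 2 * nrm y ^+ 2.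
Proof. by rewrite nrm2D nrm2B; ring. Qed.

(** A minimizing sequence is Cauchy by the parallelogram law: midpoints stay in [M], so they are no
    closer to [x] than the infimum. *)
Lemma closest_point_exists (M : set F) x : subspace M -> seq_closed M ->
  exists2 l, M l & forall m, M m -> nrm (x - l) <= nrm (x - m).
Proof.
move=> [M0 MD] Mcl.
pose D := [set nrm (x - m) ^+ 2 | m in M].
have D0 : D !=set0 by exists (nrm (x - 0) ^+ 2), 0.
have Dlb : has_lbound D by exists 0 => _ [m _ <-]; exact: sqr_ge0.
have infD : has_inf D by [].
have dle m : M m -> inf D <= nrm (x - m) ^+ 2.
  by move=> Mm; apply: ge_inf => //; exists m.
have mid y z : M y -> M z -> M (2^-1 *: (y + z)).
  move=> My Mz; rewrite -[_ *: _]addr0; apply: (MD) => //.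
  by rewrite -[y]scale1r; apply: MD.
have /choice[u uP] : forall n : nat, exists m,
    M m /\ nrm (x - m) ^+ 2 < inf D + n.+1%:R^-1.
  move=> n; have n0 : 0 < n.+1%:R^-1 :> R by rewrite invr_gt0.
  by have [_ [m Mm <-] mlt] := inf_adherent n0 infD; exists m.
have uM n : M (u n) := (uP n).1.
have ult n : nrm (x - u n) ^+ 2 < inf D + n.+1%:R^-1 := (uP n).2.
have [|l ul] := @cauchy_tends u.
  move=> e e0.
  (* The law bounds [|u m - u n|^2] by twice the sum of the two excesses over [inf D], so excesses
     below [e^2 / 4] suffice. *)
  have [|N NP] := @inv_nat_lt (e ^+ 2 / 4); first by rewrite divr_gt0// exprn_gt0.
  exists N => m n Nm Nn.
  rewrite -ltr_sqr ?nnegrE ?nrm_ge0//; last exact: ltW.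
  have := parallelogram (x - u n) (x - u m).
  have -> : x - u n + (x - u m) = 2%:C *: (x - 2^-1 *: (u n + u m)).
    rewrite scalerBr scalerA -[2%:C]/(2%:R%:C) rmorph_nat mulfV//.
    by rewrite scale1r scaler_nat mulr2n opprD addrACA.
  rewrite nrmZ cnrmR ger0_norm// exprMn.
  rewrite (_ : x - u n - (x - u m) = u m - u n); last first.
    by rewrite opprB addrC subrKA.
  have := dle _ (mid _ _ (uM n) (uM m)).
  have := ult n; have := ult m; have := NP _ Nm; have := NP _ Nn.
  by move: n.+1%:R^-1 m.+1%:R^-1 => p q; lra.
exists l; first exact: (Mcl u).
move=> m Mm; rewrite leNgt; apply/negP => lt_ml.
(* If [m] were closer than [l] by [e], a point [u n] within [e / 2] of [l] would still have squared
   distance at least [inf D + e^2 / 4]. *)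
pose e := nrm (x - l) - nrm (x - m).
have e0 : 0 < e by rewrite subr_gt0.
have [|N1 N1P] := ul (e / 2); first lra.
have [|N2 N2P] := @inv_nat_lt (e ^+ 2 / 4); first by rewrite divr_gt0// exprn_gt0.
pose n := maxn N1 N2.
have h1 := N1P n (leq_maxl _ _); have h2 := N2P n (leq_maxr _ _).
have h3 : nrm (x - m) + e / 2 <= nrm (x - u n).
  by have := nrm_tri x (u n) l; move: h1; rewrite /e; lra.
have h4 : (nrm (x - m) + e / 2) ^+ 2 <= nrm (x - u n) ^+ 2.
  by rewrite ler_sqr ?nnegrE ?nrm_ge0// addr_ge0 ?nrm_ge0//; lra.
have := ult n; have := dle _ Mm.
have : 0 <= nrm (x - m) * e by rewrite mulr_ge0 ?nrm_ge0// ltW.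
by move: h4 h2; rewrite sqrrD; move: n.+1%:R^-1 => p; lra.
Qed.

Lemma closest_point_orth (M : set F) x l : subspace M -> M l ->
  (forall m, M m -> nrm (x - l) <= nrm (x - m)) ->
  forall m, M m -> hdot m (x - l) = 0.
Proof.
move=> [M0 MD] Ml lmin m Mm.
(* Minimality is tested at [l + t c m]. For [t = 1 / (|m|^2 + 1)], defined even if [m = 0], one has
   [t |m|^2 = 1 - t], and the inequality becomes [t |c|^2 (1 + t) <= 0]. *)
pose c := hdot (x - l) m; pose t := (nrm m ^+ 2 + 1)^-1.
have m1 : 0 < nrm m ^+ 2 + 1 by have := sqr_ge0 (nrm m); lra.
have := lmin _ (MD (t%:C * c) _ _ Mm Ml).
rewrite [_ + l]addrC opprD addrA -ler_sqr ?nnegrE ?nrm_ge0//.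
rewrite [X in _ <= X]nrm2B nrmZ hdotZr.
have -> : complex.Re ((t%:C * c)^* * hdot (x - l) m) = t * cnrm c ^+ 2.
  rewrite -/c conjM conj_real_complex -mulrA [_^* * _]mulrC -normCK cnrmE.
  by rewrite -rmorphXn -real_complexM.
rewrite cnrmM cnrmR [`|t|]ger0_norm; last by rewrite invr_ge0 ltW.
move=> h.
suff c0 : cnrm c ^+ 2 <= 0.
  rewrite hdotC -/c (_ : c = 0) ?rmorph0//.
  apply/eqP; rewrite -normr_le0 cnrmE lecR.
  by rewrite -ler_sqr ?nnegrE ?cnrm_ge0// expr0n.
rewrite -(pmulr_rle0 _ m1).
have tE : t * (nrm m ^+ 2 + 1) = 1 by rewrite mulVf// gt_eqF.
have t0 : 0 < t by rewrite invr_gt0.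
have h2 : 0 <= t * cnrm c ^+ 2 * (t * nrm m ^+ 2 - 2) by move: h; lra.
have h3 : t * nrm m ^+ 2 = 1 - t by move: tE; lra.
have h4 : t * cnrm c ^+ 2 * (1 + t) <= 0 by move: h2; rewrite h3; lra.
have h5 : cnrm c ^+ 2 <= 0.
  move: h4; rewrite -mulrA (pmulr_rle0 _ t0) pmulr_lle0//; lra.
by rewrite (pmulr_rle0 _ m1).
Qed.

Lemma orth_trivial_full (M : set F) : subspace M -> seq_closed M ->
  (forall y, (forall m, M m -> hdot m y = 0) -> y = 0) -> forall x, M x.
Proof.
move=> sM cM orth x; have [l Ml lmin] := closest_point_exists x sM cM.
have /orth/eqP := closest_point_orth sM Ml lmin.
by rewrite subr_eq0 => /eqP ->.
Qed.

(** For a nonzero [v] orthogonal to the kernel, [x - (f x / f v) v] lies in the kernel, and pairing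
    it with [v] yields the representing vector. The bound [B] makes the kernel closed. *)
Lemma riesz (f : F -> C) (B : R) :
  (forall (a : C) x y, f (a *: x + y) = a * f x + f y) ->
  (forall x, cnrm (f x) <= B * nrm x) ->
  exists w, forall x, f x = hdot x w.
Proof.
move=> fl fB.
have f0 : f 0 = 0 by have := fl (-1) 0 0; rewrite scaler0 addr0 mulN1r addNr.
have fD x y : f (x + y) = f x + f y.
  by have := fl 1 x y; rewrite scale1r mul1r.
have fZ a x : f (a *: x) = a * f x.
  by have := fl a x 0; rewrite f0 !addr0.
pose M := [set x | f x = 0].
have [MT|] := pselect (forall x, M x).
  by exists 0 => x; rewrite hdot0r MT.
have sM : subspace M.
  by split=> // a x y /= fx fy; rewrite /M/= fl fx fy mulr0 addr0.
have cM : seq_closed M.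
  move=> u l uM ul /=.
  apply/eqP; rewrite -normr_le0 cnrmE lecR.
  apply/ler_addgt0Pr => e e0; rewrite add0r.
  have B1 : 0 < `|B| + 1 by have := normr_ge0 B; lra.
  have [|N NP] := ul (e / (`|B| + 1)); first by rewrite divr_gt0.
  have := NP N (leqnn N); rewrite ltr_pdivlMr// => h.
  have -> : f l = f (l - u N) by rewrite fD -scaleN1r fZ uM mulr0 addr0.
  have := fB (l - u N); rewrite nrmBC.
  have := ler_wpM2r (nrm_ge0 (u N - l)) (ler_norm B).
  by have := nrm_ge0 (u N - l); lra.
move=> nMT; have [v] : exists v, ~ (v = 0 \/ exists2 m, M m & hdot m v <> 0).
  apply: contra_notP nMT => h; apply: orth_trivial_full => // y yM.
  by apply: contrapT => y0; apply: h; exists y => -[//|[m Mm]]; rewrite yM.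
move=> /not_orP[/eqP v0 vM].
have vorth m : M m -> hdot m v = 0.
  by move=> Mm; apply: contrapT => h; apply: vM; exists m.
have vv : hdot v v != 0 :> C by apply: contra_neq v0; exact: hdot_eq0.
have fv : f v != 0.
  by apply/eqP => fv; move/eqP: v0; apply; apply/hdot_eq0/vorth.
exists ((f v / hdot v v)^* *: v) => x.
have : M (x - (f x / f v) *: v).
  by rewrite /M/= fD -scaleN1r scalerA fZ mulN1r mulNr divfK// subrr.
move/vorth; rewrite hdotDl hdotNl hdotZl => /eqP; rewrite subr_eq0 => /eqP xv.
by rewrite hdotZr conjCK xv; field; rewrite fv.
Qed.

End Convergence.

(** * Adjoints and surjectivity *)

Section Adjoint.
Variables (R : realType).
Local Notation C := R[i].

Lemma adjointP (U V V' : Type) (U' : lmodType C) (p : U -> U' -> C)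
    (q : V -> V' -> C) (L : U -> V) y :
  (exists w, forall x, q (L x) y = p x w) ->
  forall x, q (L x) y = p x (adjoint p q L y).
Proof. by move=> [w Lw] x; rewrite /adjoint; case: xgetP => [v _ //|/(_ w)]. Qed.

Lemma adjoint_unique (U V V' : Type) (U' : lmodType C) (p : U -> U' -> C)
    (q : V -> V' -> C) (L : U -> V) y w :
  (forall x, q (L x) y = p x w) ->
  (forall v, (forall x, p x v = p x w) -> v = w) ->
  adjoint p q L y = w.
Proof.
move=> Lw inj; apply: inj => x; rewrite -Lw; apply/esym.
by apply: adjointP; exists w.
Qed.

Variable F : hilbertType C.
Implicit Types (L : F -> F).

Definition adj L : F -> F := adjoint (@hdot _ F) (@hdot _ F) L.

Lemma adjE L x y : bounded_linear L -> hdot (L x) y = hdot x (adj L y).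
Proof.
move=> /bounded_linearP[lL [M M0 bL]]; move: x; apply: adjointP.
apply: (@riesz _ _ _ (M * nrm y)) => [a x1 x2|x].
  by rewrite lL hdotDl hdotZl.
rewrite (le_trans (cauchy_schwarz _ _))// mulrAC ler_wpM2r ?nrm_ge0//.
Qed.

Lemma adjEr L x y : bounded_linear L -> hdot x (L y) = hdot (adj L x) y.
Proof. by move=> bL; rewrite hdotC adjE// -hdotC. Qed.

Lemma adj_unique L y w :
  (forall x, hdot (L x) y = hdot x w) -> adj L y = w.
Proof. by move=> Lw; apply: adjoint_unique => // v; exact: hdot_inj. Qed.

Lemma adj_linear L : bounded_linear L -> linear (adj L).
Proof.
move=> bL a x y; apply: hdot_inj => w.
by rewrite !hdotE -!adjE// !hdotE.
Qed.

(** Follows from [|L^* x|^2 = <L L^* x, x>]. Keeping the constant [q] is what makes [1 - G^*]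
    surjective along with [1 - G] when [q < 1]. *)
Lemma adj_bound L (q : R) : bounded_linear L ->
  (forall x, nrm (L x) <= q * nrm x) -> forall x, nrm (adj L x) <= q * nrm x.
Proof.
move=> bL Lq x; have [->|ax0] := eqVneq (adj L x) 0.
  by rewrite nrm0 (le_trans (nrm_ge0 _) (Lq _)).
have a0 : 0 < nrm (adj L x).
  by rewrite lt_def nrm_ge0 andbT; apply: contra_neq ax0 => /nrm_eq0.
rewrite -(ler_pM2l a0) -expr2 nrm2 -adjE//.
rewrite (le_trans (Re_hdot_le _ _))//.
by rewrite mulrCA mulrA ler_wpM2r ?nrm_ge0.
Qed.

Lemma adj_bounded L : bounded_linear L -> bounded_linear (adj L).
Proof.
move=> bL; apply/bounded_linearP; split; first exact: adj_linear.
have /bounded_linearP[_ [M M0 LM]] := bL.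
by exists M => //; exact: adj_bound.
Qed.

End Adjoint.

Section Surjectivity.
Variables (R : realType) (F : hilbertType R[i]).
Local Notation C := R[i].
Implicit Types (T : pop F F) (x y : F).

Lemma linopD T x y : is_linop T -> pdom T x -> pdom T y ->
  pdom T (x + y) /\ T (x + y) = T x + T y.
Proof.
move=> [_ TD TE] Tx Ty; have := TE 1 x y Tx Ty; have := TD 1 x y Tx Ty.
by rewrite !scale1r.
Qed.

Lemma linop0 T : is_linop T -> T 0 = 0.
Proof.
move=> [T0 TD TE]; have := TE (-1) 0 0 T0 T0.
by rewrite scaler0 addr0 scaleN1r addNr.
Qed.

Lemma linopZ T (a : C) x : is_linop T -> pdom T x ->
  pdom T (a *: x) /\ T (a *: x) = a *: T x.
Proof.
move=> lT Tx; have [T0 TD TE] := lT.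
have := TE a x 0 Tx T0; have := TD a x 0 Tx T0.
by rewrite linop0// !addr0.
Qed.

Lemma linopB T x y : is_linop T -> pdom T x -> pdom T y ->
  pdom T (x - y) /\ T (x - y) = T x - T y.
Proof.
move=> lT Tx Ty; have [dy Ey] := linopZ (-1) lT Ty.
by have := linopD lT Tx dy; rewrite Ey !scaleN1r.
Qed.

Definition closed_op T := forall u x y, (forall n, pdom T (u n)) ->
  tends u x -> tends (fun n => T (u n)) y -> pdom T x /\ T x = y.

(** The lower bound turns convergence of images into convergence of preimages, so the range of the
    closed [T] is closed; the last hypothesis says that its orthogonal complement is trivial. *)
Lemma closed_range_surjective T (d : R) : is_linop T -> closed_op T -> 0 < d ->
  (forall x, pdom T x -> d * nrm x <= nrm (T x)) ->
  (forall y, (forall x, pdom T x -> hdot (T x) y = 0) -> y = 0) ->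
  forall f, exists2 x, pdom T x & T x = f.
Proof.
move=> lT cT d0 dT orth f.
have [T0 TD TE] := lT.
pose M := [set g | exists2 x, pdom T x & T x = g].
suff: M f by [].
apply: orth_trivial_full => [||y yM].
- split; first by exists 0 => //; exact: linop0.
  move=> a _ _ [x Tx <-] [y Ty <-]; exists (a *: x + y); first exact: TD.
  exact: TE.
- move=> g l /= gM gl.
  have /choice[u uP] : forall n, exists x, pdom T x /\ T x = g n.
    by move=> n; have [x ? ?] := gM n; exists x.
  have [|x ux] := @cauchy_tends _ _ u.
    move=> e e0; have de : 0 < d * e / 2 by rewrite divr_gt0// mulr_gt0.
    have [N NP] := gl _ de; exists N => m n Nm Nn.
    have [dmn Emn] := linopB lT (uP m).1 (uP n).1.
    have := dT _ dmn; rewrite Emn (uP m).2 (uP n).2 => h.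
    rewrite -(ltr_pM2l d0); have := nrm_tri (g m) l (g n).
    by have := NP _ Nm; have := NP _ Nn; rewrite (nrmBC l (g n)); lra.
  have [|] := cT u x l (fun n => (uP n).1) ux; last by exists x.
  by rewrite (_ : (fun n => T (u n)) = g)//; apply/funext => n; case: (uP n).
- by apply: orth => x Tx; apply: yM; exists x.
Qed.

Lemma tends_sub u v x y : tends u x -> tends v y ->
  tends (fun n => u n - v n) (x - y :> F).
Proof.
move=> ux vy e e0; have e2 : 0 < e / 2 by rewrite divr_gt0.
have [N NP] := ux _ e2; have [N' NP'] := vy _ e2.
exists (maxn N N') => n; rewrite geq_max => /andP[/NP h1 /NP' h2].
rewrite (opprD x) opprK addrACA -[y]opprK -opprD.
by have := nrmB (u n - x) (v n - y); lra.
Qed.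

(** Instead of a Neumann series: [1 - B] is bounded below by [1 - q], and [y] orthogonal to its
    range satisfies [<y, y> = <B y, y> <= q |y|^2], hence [y = 0]. *)
Lemma contraction_surjective (B : F -> F) (q : R) : linear B -> q < 1 ->
  (forall x, nrm (B x) <= q * nrm x) -> forall f, exists x, x - B x = f.
Proof.
move=> lB q1 Bq f.
have bB : bounded_linear B.
  apply/bounded_linearP; split=> //; exists `|q| => // x.
  by rewrite (le_trans (Bq x))// ler_wpM2r ?nrm_ge0// ler_norm.
have lb x : (1 - q) * nrm x <= nrm (x - B x).
  have := nrm_tri x (B x) 0; rewrite !subr0.
  by have := Bq x; lra.
have [|||||x _ xf] := @closed_range_surjective
  (Pop setT (fun x => x - B x)) (1 - q) _ _ _ _ _ f; last by exists x.
- split=> // a x y _ _ /=; rewrite lB scalerBr; apply/eqP.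
  by rewrite opprD addrACA.
- move=> u x y _ ux /= uy; split=> //.
  by apply: tends_unique uy; apply: tends_sub => //; exact: tends_bounded.
- by rewrite subr_gt0.
- by move=> x _; exact: lb.
- move=> y yM; apply: nrm_le0.
  have := yM y Logic.I; rewrite /= hdotDl hdotNl => /eqP.
  rewrite subr_eq0 => /eqP yy; have := Re_hdot_le (B y) y.
  rewrite -yy -nrm2 => h; have := ler_wpM2r (nrm_ge0 y) (Bq y) => h2.
  have : (1 - q) * nrm y ^+ 2 <= 0 by move: h h2; lra.
  rewrite pmulr_rle0 ?subr_gt0// => h3; rewrite -ler_sqr ?nnegrE ?nrm_ge0//.
  by rewrite expr0n.
Qed.

End Surjectivity.

(** * Self-adjoint operators and resolvents *)

Section BoundedInverse.
Variables (R : realType) (U V : normedModType R[i]).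

Lemma bounded_inverse_unique (P : pop U V) L L' :
  bounded_inverse P L -> bounded_inverse P L' -> L = L'.
Proof.
move=> [_ _ PL] [_ PL' _]; apply/funext => y.
by have [dy <-] := PL' y; rewrite PL//; have [_ ->] := PL' y.
Qed.

Lemma bounded_inverse_intro (P : pop U V) (d : R) :
  is_linop P -> 0 < d -> (forall x, pdom P x -> d * nrm x <= nrm (P x)) ->
  (forall f, exists2 x, pdom P x & P x = f) ->
  exists L, bounded_inverse P L.
Proof.
move=> [P0 PD PE] d0 dP surjP.
have /choice[L LP] : forall f, exists x, pdom P x /\ P x = f.
  by move=> f; have [x] := surjP f; exists x.
have inj x y : pdom P x -> pdom P y -> P x = P y -> x = y.
  move=> Px Py Pxy; apply/eqP; rewrite -subr_eq0; apply/eqP/nrm_le0.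
  have := dP _ (PD (-1) _ _ Py Px); rewrite PE// Pxy !scaleN1r addNr nrm0.
  by rewrite addrC pmulr_rle0.
exists L; split=> // [|x Px]; last by apply: inj => //; case: (LP (P x)).
apply/bounded_linearP; split=> [a x y|].
  have [dx Ex] := LP x; have [dy Ey] := LP y; have [dz Ez] := LP (a *: x + y).
  by apply: inj => //; [exact: PD|rewrite PE// Ex Ey].
exists d^-1 => [|y]; first by rewrite invr_ge0 ltW.
have [dy Ey] := LP y; have := dP _ dy; rewrite Ey => h.
by rewrite mulrC ler_pdivlMr// mulrC.
Qed.

End BoundedInverse.

Section SelfAdjoint.
Variables (R : realType) (F : hilbertType R[i]).
Local Notation C := R[i].
Implicit Types (T : pop F F) (x y : F).

Lemma denseE (D : set F) : dense D <->
  forall x (e : R), 0 < e -> exists2 y, D y & nrm (x - y) < e.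
Proof.
split=> [dD x e e0|h O [x Ox] oO].
  have e0C : 0 < e%:C :> C by rewrite ltcR.
  have [|y [yb Dy]] := dD _ _ (ball_open x e%:C).
    by exists x; exact: ballxx.
  by exists y => //; move: yb; rewrite -ball_normE/= nrmE ltcR.
have /nbhs_ballP[e /= e0 eO] : nbhs x O by exact: open_nbhs_nbhs.
have eE : e = (complex.Re e)%:C by rewrite RRe_real// gtr0_real.
have [|y Dy xy] := h x (complex.Re e); first by rewrite -ltcR -eE.
by exists y; split=> //; apply: eO; rewrite -ball_normE/= nrmE eE ltcR.
Qed.

Lemma dense_orth (D : set F) y : dense D ->
  (forall x, D x -> hdot x y = 0) -> y = 0.
Proof.
move=> /denseE dD yD; apply: nrm_le0.
apply/ler_addgt0Pr => e e0; rewrite add0r leNgt; apply/negP => ye.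
have [x Dx xy] := dD y e e0.
have := Re_hdot_le (y - x) y; rewrite hdotDl hdotNl (yD x Dx) subr0 -nrm2.
by rewrite expr2 ler_pM2r ?(lt_trans e0)// leNgt (lt_trans xy).
Qed.

Lemma tends_hdot u v x y a b : tends u x -> tends v y ->
  (forall n, hdot (u n) a = hdot (v n) b) -> hdot x a = hdot y b :> C.
Proof.
move=> ux vy uv; apply/eqP; rewrite -subr_eq0 -normr_le0 cnrmE lecR.
apply/ler_addgt0Pr => e e0; rewrite add0r.
have [M [aM bM M0]] : exists M : R, [/\ nrm a <= M, nrm b <= M & 0 < M].
  exists (nrm a + nrm b + 1); have := nrm_ge0 a; have := nrm_ge0 b.
  by split; lra.
have eM : 0 < e / (2 * M) by rewrite divr_gt0// mulr_gt0.
have [N NP] := ux _ eM; have [N' NP'] := vy _ eM.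
have := NP _ (leq_maxl N N'); have := NP' _ (leq_maxr N N').
set n := maxn N N' => h1 h2.
have -> : hdot x a - hdot y b = hdot (x - u n) a - hdot (y - v n) b.
  by rewrite !hdotE uv; ring.
have := cnrmD (hdot (x - u n) a) (- hdot (y - v n) b).
rewrite -hdotNl opprB.
have := cauchy_schwarz (x - u n) a; have := cauchy_schwarz (v n - y) b.
have := ler_wpM2l (nrm_ge0 (x - u n)) aM.
have := ler_wpM2l (nrm_ge0 (v n - y)) bM.
move: h1 h2; rewrite (nrmBC (u n)) !ltr_pdivlMr ?mulr_gt0//; lra.
Qed.

(** Density makes the choice in [adjoint_op] unique, so self-adjointness becomes symmetry plus
    maximality: the graph contains every adjoint pair [(y, w)]. *)
Lemma self_adjointP T : self_adjoint T -> [/\ is_linop T, dense (pdom T),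
  symmetric_op T & forall y w, (forall x, pdom T x -> hdot (T x) y = hdot x w) ->
    pdom T y /\ T y = w].
Proof.
move=> [lT dT adjD adjE].
have uniq y w w' : (forall x, pdom T x -> hdot (T x) y = hdot x w) ->
    (forall x, pdom T x -> hdot (T x) y = hdot x w') -> w = w'.
  move=> h h'; apply/eqP; rewrite -subr_eq0; apply/eqP.
  by apply: (dense_orth dT) => x Tx; rewrite hdotDr hdotNr -h// -h'// subrr.
have adjP y x : pdom T y -> pdom T x -> hdot (T x) y = hdot x (T y).
  move=> Ty Tx; rewrite -[in RHS](adjE _ Ty) /adjoint_op/=.
  have : pdom (adjoint_op T) y by rewrite adjD.
  by move=> [w wP]; case: xgetP => [v _ vP|/(_ w)//]; exact: vP.
split=> // [x y Tx Ty|y w yw]; first exact: adjP.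
have Ty : pdom T y by rewrite -adjD; exists w.
by split=> //; apply: uniq yw => x Tx; exact: adjP.
Qed.

Lemma self_adjoint_intro T : is_linop T -> dense (pdom T) -> symmetric_op T ->
  (forall y w, (forall x, pdom T x -> hdot (T x) y = hdot x w) -> pdom T y) ->
  self_adjoint T.
Proof.
move=> lT dT sT maxT; split=> //.
  apply/seteqP; split=> y; first by move=> [w /maxT].
  by move=> Ty; exists (T y) => x Tx; exact: sT.
move=> y Ty; apply/eqP; rewrite -subr_eq0; apply/eqP.
apply: (dense_orth dT) => x Tx; rewrite hdotDr hdotNr -sT//.
rewrite /adjoint_op/=; case: xgetP => [w _ ->//|/(_ (T y)) h]; first exact: subrr.
by exfalso; apply: h => v Tv; exact: sT.
Qed.

(** If [(y, w)] is an adjoint pair and [w = T x], then [y - x] is orthogonal to the range of [T],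
    which is everything. *)
Lemma symmetric_surjective_self_adjoint T : is_linop T -> dense (pdom T) ->
  symmetric_op T -> (forall f, exists2 x, pdom T x & T x = f) ->
  self_adjoint T.
Proof.
move=> lT dT sT surjT; apply: self_adjoint_intro => // y w yw.
have [x Tx xw] := surjT w; rewrite (_ : y = x)//.
apply: hdot_inj => f; have [v Tv <-] := surjT f.
by rewrite yw// -xw sT.
Qed.

(** An adjoint pair [(y, w)] of [T] gives the adjoint pair [(y, w - B^* y)] of [K]. Symmetry is
    asked of [T] because for [H_S] it comes straight from the factorization, whereas [B] will be an
    unwieldy expression. *)
Lemma self_adjoint_add_bounded T K (B : F -> F) : self_adjoint K ->
  bounded_linear B -> pdom T = pdom K ->
  (forall x, pdom K x -> T x = K x + B x) -> symmetric_op T -> self_adjoint T.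
Proof.
move=> /self_adjointP[lK dK sK maxK] bB TK TE sT.
have [K0 KD KE] := lK; have [lB _] := bB.
apply: self_adjoint_intro => //; rewrite ?TK//.
- split; rewrite ?TK// => a x y Kx Ky; rewrite !TE//; last exact: KD.
  by rewrite KE// lB scalerDr addrACA.
- move=> y w yw; have [x Kx|//] := maxK y (w - adj B y).
  have := yw x Kx; rewrite TE// hdotDl hdotDr hdotNr -adjE// => <-.
  by rewrite addrK.
Qed.

Lemma symmetric_Im T x : symmetric_op T -> pdom T x ->
  hdot (T x) x = (complex.Re (hdot (T x) x))%:C.
Proof.
move=> sT Tx; apply: conj_eq_real.
by rewrite -hdotC -sT.
Qed.

Lemma bounded_belowP T : symmetric_op T -> bounded_below T <->
  exists c : R, forall x, pdom T x ->
    c * nrm x ^+ 2 <= complex.Re (hdot (T x) x).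
Proof.
move=> sT; split=> -[c cT]; exists c => x Tx.
  have := cT x Tx; rewrite symmetric_Im// nrmE -rmorphXn/=.
  by rewrite -real_complexM lecR.
rewrite symmetric_Im// nrmE -rmorphXn/= -real_complexM lecR; exact: cT.
Qed.

Lemma resolventP T z : resolvent_set T z ->
  bounded_inverse (shift_op T z) (resolvent T z).
Proof. by move=> [L LP]; rewrite /resolvent; case: xgetP => [//|/(_ L)]. Qed.

Lemma resolvent_eq T z L : bounded_inverse (shift_op T z) L ->
  resolvent T z = L.
Proof.
move=> LP; apply: (bounded_inverse_unique _ LP).
by apply: resolventP; exists L.
Qed.

Lemma resolvent_dom T z x : resolvent_set T z -> pdom T (resolvent T z x).
Proof. by move=> /resolventP[_ /(_ x)[]]. Qed.

Lemma resolvent_app T z x : resolvent_set T z ->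
  T (resolvent T z x) = z *: resolvent T z x - x.
Proof.
move=> /resolventP[_ /(_ x)[_ {3}<-]] _ /=.
by rewrite opprD opprK addrCA subrr addr0.
Qed.

Lemma resolventK T z x : resolvent_set T z -> pdom T x ->
  resolvent T z (- T x + z *: x) = x.
Proof. by move=> /resolventP[_ _ h] Tx; exact: h. Qed.

Lemma resolvent_bounded T z : resolvent_set T z ->
  bounded_linear (resolvent T z).
Proof. by move=> /resolventP[]. Qed.

Lemma resolvent_comm T z x : resolvent_set T z -> pdom T x ->
  resolvent T z (T x) = z *: resolvent T z x - x.
Proof.
move=> zT Tx; have [lR _] := resolvent_bounded zT.
have := resolventK zT Tx.
rewrite linear_addl// linear_opp// linear_scale// => {3}<-.
by rewrite opprD opprK addrCA subrr addr0.
Qed.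

(** The adjoint of the resolvent maps into dom(T) by maximality, because the resolvent commutes with
    [T] on dom(T). *)
Lemma resolvent_conj T z : self_adjoint T -> resolvent_set T z ->
  bounded_inverse (shift_op T z^*) (adj (resolvent T z)).
Proof.
move=> /self_adjointP[lT dT sT maxT] zT.
have bR := resolvent_bounded zT.
have adjT y : pdom T (adj (resolvent T z) y) /\
    T (adj (resolvent T z) y) = z^* *: adj (resolvent T z) y - y.
  apply: maxT => x Tx.
  by rewrite -adjE// resolvent_comm// !hdotE conjCK -adjE.
split; first exact: adj_bounded.
- move=> y; have [dy Ey] := adjT y; split=> //=.
  by rewrite Ey opprD opprK addrAC addNr add0r.
- move=> x Tx; apply: hdot_inj => w; rewrite -adjE// /= hdotDr hdotNr hdotZr conjCK.
  rewrite -sT//; last exact: resolvent_dom.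
  by rewrite resolvent_app// hdotDl hdotNl hdotZl; ring.
Qed.

Lemma resolvent_set_conj T z : self_adjoint T -> resolvent_set T z ->
  resolvent_set T z^*.
Proof. by move=> sT zT; eexists; exact: resolvent_conj. Qed.

Lemma resolvent_adj T z x y : self_adjoint T -> resolvent_set T z ->
  hdot (resolvent T z x) y = hdot x (resolvent T z^* y).
Proof.
move=> sT zT; rewrite (resolvent_eq (resolvent_conj sT zT)).
by rewrite -adjE//; exact: resolvent_bounded.
Qed.

Lemma self_adjoint_closed T : self_adjoint T -> closed_op T.
Proof.
move=> /self_adjointP[lT dT sT maxT] u x y Tu ux Tuy; apply: maxT => v Tv.
rewrite hdotC [RHS]hdotC; congr (_^*).
by apply: (tends_hdot ux Tuy) => n; rewrite sT.
Qed.

(** The sign is opposite to that of [shift_op], so that the operator is positive for [mu] below the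
    lower bound of [T]. *)
Definition shift_sub T (mu : R) : pop F F :=
  Pop (pdom T) (fun x => T x - mu%:C *: x).

Lemma shift_sub_lower T (c mu : R) x :
  (forall x, pdom T x -> c * nrm x ^+ 2 <= complex.Re (hdot (T x) x)) ->
  pdom T x -> (c - mu) * nrm x ^+ 2 <= complex.Re (hdot (shift_sub T mu x) x).
Proof.
move=> cT Tx; rewrite /= hdotDl hdotNl hdotZl hdotxx -real_complexM.
by rewrite raddfB/=; have := cT x Tx; lra.
Qed.

Lemma coercive_bound (x g : F) (d : R) :
  d * nrm x ^+ 2 <= complex.Re (hdot g x) -> d * nrm x <= nrm g.
Proof.
move=> h; have [->|x0] := eqVneq x 0; first by rewrite nrm0 mulr0 nrm_ge0.
have nx : 0 < nrm x.
  by rewrite lt_def nrm_ge0 andbT; apply: contra_neq x0 => /nrm_eq0.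
by rewrite -(ler_pM2r nx) -mulrA -expr2 (le_trans h)// Re_hdot_le.
Qed.

Lemma shift_sub_linop T mu : is_linop T -> is_linop (shift_sub T mu).
Proof.
move=> [T0 TD TE]; split=> //= a x y Tx Ty; rewrite TE//.
by rewrite !scalerDr !scalerA opprD addrACA scalerN scalerA mulrC.
Qed.

Lemma shift_sub_symmetric T mu : symmetric_op T -> symmetric_op (shift_sub T mu).
Proof.
move=> sT x y Tx Ty; rewrite /= !hdotE conj_real_complex.
by rewrite sT.
Qed.

(** By maximality a nonzero vector orthogonal to the range would be an eigenvector for [mu], which
    lies below the lower bound [c]. *)
Lemma shift_sub_surjective T (c mu : R) : self_adjoint T ->
  (forall x, pdom T x -> c * nrm x ^+ 2 <= complex.Re (hdot (T x) x)) ->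
  mu < c -> forall f, exists2 x, pdom T x & T x - mu%:C *: x = f.
Proof.
move=> sa cT muc f; have [lT dT sT maxT] := self_adjointP sa.
apply: (@closed_range_surjective _ _ (shift_sub T mu) (c - mu)).
- exact: shift_sub_linop.
- move=> u x y Tu ux uy.
  suff [Tx Exy] : pdom T x /\ T x = y + mu%:C *: x.
    by split=> //=; rewrite Exy addrK.
  apply: (self_adjoint_closed sa Tu ux).
  have bZ : bounded_linear (fun x : F => - (mu%:C *: x)).
    by apply/bounded_opp/bounded_scale/bounded_id.
  have := tends_sub uy (tends_bounded bZ ux).
  rewrite opprK; congr tends; apply/funext => n /=.
  by rewrite opprK subrK.
- by rewrite subr_gt0.
- by move=> x Tx; apply: coercive_bound; exact: shift_sub_lower.
- move=> y yT.
  have [Ty Ey] : pdom T y /\ T y = mu%:C *: y.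
    apply: maxT => x Tx; have /= := yT x Tx.
    rewrite hdotDl hdotNl hdotZl hdotZr conj_real_complex => /eqP.
    by rewrite subr_eq0 => /eqP.
  have := shift_sub_lower mu cT Ty; rewrite /= Ey subrr hdot0l/=.
  rewrite pmulr_rle0 ?subr_gt0// => h3; apply: nrm_le0.
  by rewrite -ler_sqr ?nnegrE ?nrm_ge0// expr0n.
Qed.

Lemma resolvent_set_below T (c mu : R) : self_adjoint T ->
  (forall x, pdom T x -> c * nrm x ^+ 2 <= complex.Re (hdot (T x) x)) ->
  mu < c -> resolvent_set T mu%:C.
Proof.
move=> sa cT muc; have [lT _ _ _] := self_adjointP sa.
have [P0 PD PE] := lT.
apply: (@bounded_inverse_intro _ _ _ _ (c - mu)).
- split=> //= a x y Tx Ty.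
  by rewrite PE// scalerDr opprD -scalerN !scalerDr !scalerA addrACA mulrC.
- by rewrite subr_gt0.
- move=> x Tx /=; rewrite -[nrm (- _ + _)]nrmN opprD opprK.
  by apply: coercive_bound; exact: shift_sub_lower.
- move=> f; have [x Tx xf] := shift_sub_surjective sa cT muc (- f).
  by exists x => //=; rewrite -[RHS]opprK -xf opprB addrC.
Qed.

End SelfAdjoint.

(** * Form bounds and relative bounds *)

Section FormBound.
Variable R : realType.
Local Notation C := R[i].

Lemma bernoulli (h : R) n : 0 <= h -> 1 + n%:R * h <= (1 + h) ^+ n.
Proof.
move=> h0; elim: n => [|n IH]; first by rewrite mul0r addr0 expr0.
rewrite exprS (le_trans _ (ler_wpM2l _ IH)) ?addr_ge0//.
by rewrite -natr1; have := mulr_ge0 (ler0n R n) (sqr_ge0 h); lra.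
Qed.

(** Log-convexity makes the ratios of successive terms nondecreasing. If the first ratio [t]
    exceeded [r], then [A n >= t^n A 0], and by Bernoulli's inequality [(t / r)^n] would outgrow
    [K / A 0]. *)
Lemma log_convex_ratio (A : nat -> R) (K r : R) : 0 <= r ->
  (forall n, 0 <= A n) -> (forall n, A n.+1 ^+ 2 <= A n * A n.+2) ->
  (forall n, A n <= K * r ^+ n) -> A 1%N <= r * A 0%N.
Proof.
move=> r0 A0 Acvx AK; rewrite leNgt; apply/negP => rA.
have a0 : 0 < A 0%N.
  rewrite lt_def A0 andbT; apply: contraTneq rA => a0; rewrite a0 mulr0 -leNgt.
  have := Acvx 0%N; rewrite a0 mul0r => h.
  by rewrite -ler_sqr ?nnegrE// expr0n.
have r_gt0 : 0 < r.
  rewrite lt_def r0 andbT; apply: contraTneq rA => r1; rewrite r1 mul0r -leNgt.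
  by have := AK 1%N; rewrite r1 expr1 mulr0.
pose t := A 1%N / A 0%N.
have rt : r < t by rewrite ltr_pdivlMr.
have t0 : 0 < t := lt_trans r_gt0 rt.
have step n : 0 < A n /\ t * A n <= A n.+1.
  elim: n => [|n [An IH]]; first by rewrite divfK ?gt_eqF.
  have An1 : 0 < A n.+1 by rewrite (lt_le_trans _ IH)// mulr_gt0.
  split=> //; rewrite -(ler_pM2l An) (le_trans _ (Acvx n))//.
  by rewrite expr2 mulrA [A n * t]mulrC ler_pM2r.
have grow n : t ^+ n * A 0%N <= A n.
  elim: n => [|n IH]; first by rewrite expr0 mul1r.
  by rewrite exprS -mulrA (le_trans _ (step n).2)// ler_pM2l.
pose h := t / r - 1.
have h0 : 0 < h by rewrite subr_gt0 ltr_pdivlMr// mul1r.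
have bnd n : (1 + h) ^+ n <= K / A 0%N.
  rewrite addrC subrK expr_div_n ler_pdivrMr ?exprn_gt0// mulrAC.
  by rewrite ler_pdivlMr// (le_trans (grow n)).
pose n := Num.bound (K / A 0%N / h).
have Kh : 0 <= K / A 0%N / h.
  apply: divr_ge0; last exact: ltW.
  by rewrite (le_trans _ (bnd 0%N)).
have := archi_boundP Kh; rewrite -/n ltr_pdivrMr// => hn.
have := le_trans (bernoulli n (ltW h0)) (bnd n).
by lra.
Qed.

Variable F : hilbertType C.

Lemma form_cauchy_schwarz (T : pop F F) (x y : F) : is_linop T ->
  symmetric_op T -> (forall x, pdom T x -> 0 <= complex.Re (hdot (T x) x)) ->
  (complex.Re (hdot (T y) y) = 0 -> y = 0) -> pdom T x -> pdom T y ->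
  complex.Re (hdot (T x) y) ^+ 2 <=
    complex.Re (hdot (T x) x) * complex.Re (hdot (T y) y).
Proof.
move=> lT sT T0 Ty0 Tx Ty.
set p := complex.Re (hdot (T x) y); set a := complex.Re (hdot (T x) x).
set b := complex.Re (hdot (T y) y).
have [b0|b0] := eqVneq b 0.
  by rewrite b0 mulr0 /p (Ty0 b0) hdot0r/= expr0n.
have b_gt0 : 0 < b by rewrite lt_def b0 T0.
(* Positivity at [b x - p y] reads [b (a b - p^2) >= 0]; real coefficients suffice, as only the real
   part of the mixed term is estimated. *)
have [dx Ex] := linopZ b%:C lT Tx; have [dy Ey] := linopZ p%:C lT Ty.
have [dz Ez] := linopB lT dx dy.
have := T0 _ dz; rewrite Ez Ex Ey !hdotE !conj_real_complex.
have -> : hdot (T y) x = (hdot (T x) y)^* by rewrite sT// -hdotC.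
rewrite !(ReD, ReN, mulrN, ReZ, ReJ) -/a -/b -/p => h.
have : 0 <= b * (a * b - p ^+ 2) by move: h; lra.
by rewrite pmulr_rge0// subr_ge0.
Qed.

(* Krein's symmetrization trick: T^-1 S is symmetric for the scalar product
   <T x, y>, so the squared norms of (T^-1 S)^n x in it are log-convex in n,
   while |T (T^-1 S)^n x| <= q^n |T x|. *)
Lemma form_bound (T S : pop F F) (d q : R) : is_linop T -> symmetric_op T ->
  symmetric_op S -> pdom T `<=` pdom S -> 0 < d -> 0 <= q ->
  (forall x, pdom T x -> d * nrm x ^+ 2 <= complex.Re (hdot (T x) x)) ->
  (forall f, exists2 x, pdom T x & T x = f) ->
  (forall x, pdom T x -> nrm (S x) <= q * nrm (T x)) ->
  forall x, pdom T x ->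
    complex.Re (hdot (S x) x) <= q * complex.Re (hdot (T x) x).
Proof.
move=> lT sT sS TS d0 q0 dT surjT Sq x Tx.
have /choice[Z ZP] : forall y, exists v, pdom T v /\ T v = S y.
  by move=> y; have [v] := surjT (S y); exists v.
pose u n := iter n Z x; pose A n := complex.Re (hdot (T (u n)) (u n)).
have Tu n : pdom T (u n) by case: n => [//|n]; exact: (ZP _).1.
have TuS n : T (u n.+1) = S (u n) := (ZP _).2.
have T0 y : pdom T y -> 0 <= complex.Re (hdot (T y) y).
  by move=> /dT; apply: le_trans; rewrite mulr_ge0 ?sqr_ge0// ltW.
have Tpos y : pdom T y -> complex.Re (hdot (T y) y) = 0 -> y = 0.
  move=> /dT + y0; rewrite y0 pmulr_rle0// => h; apply: nrm_le0.
  by rewrite -ler_sqr ?nnegrE ?nrm_ge0// expr0n.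
have CS y z : pdom T y -> pdom T z -> complex.Re (hdot (T y) z) ^+ 2 <=
    complex.Re (hdot (T y) y) * complex.Re (hdot (T z) z).
  by move=> Ty Tz; apply: form_cauchy_schwarz => //; exact: Tpos.
have A1 : A 1%N <= q ^+ 2 * A 0%N.
  apply: (@log_convex_ratio _ (nrm (T x) ^+ 2 / d)) => [|n|n|n].
  - exact: sqr_ge0.
  - exact: T0.
  (* Moving [S] across turns [<T u_{n+1}, u_{n+1}>] into [<T u_n, u_{n+2}>] up to the real part, so
     log-convexity is the Cauchy-Schwarz inequality of the form. *)
  - rewrite /A [X in X ^+ 2](_ : _ = complex.Re (hdot (T (u n)) (u n.+2))).
      exact: CS.
    rewrite TuS sT// TuS sS//; [exact: TS|exact: TS].
  - have Tn : nrm (T (u n)) <= q ^+ n * nrm (T x).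
      elim: n => [|n IH]; first by rewrite expr0 mul1r.
      by rewrite TuS exprS -mulrA (le_trans (Sq _ (Tu n)))// ler_wpM2l.
    rewrite mulrAC ler_pdivlMr//.
    have h1 := coercive_bound (dT _ (Tu n)).
    have h2 : A n * d <= nrm (T (u n)) ^+ 2.
      rewrite (le_trans (ler_wpM2r (ltW d0) (Re_hdot_le _ _)))//.
      by rewrite -mulrA expr2 ler_wpM2l ?nrm_ge0// mulrC.
    rewrite (le_trans h2)// -exprM mulnC exprM -exprMn mulrC.
    by rewrite ler_sqr ?nnegrE ?mulr_ge0 ?exprn_ge0 ?nrm_ge0.
(* [<S x, x>] is [<T u_1, x>], and when its real part is positive, the square of that part is at
   most [A 1 * A 0 <= (q * A 0)^2]. *)
rewrite -(TuS 0%N).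
have [h|h] := leP (complex.Re (hdot (T (u 1%N)) x)) 0.
  by rewrite (le_trans h)// mulr_ge0// T0.
rewrite -ler_sqr ?nnegrE ?mulr_ge0 ?T0//; last exact: ltW.
rewrite (le_trans (CS _ _ (Tu 1%N) Tx))// exprMn [X in _ <= _ * X]expr2 mulrA.
by rewrite ler_wpM2r ?T0.
Qed.

End FormBound.

Section RelativeBound.
Variables (R : realType) (F : hilbertType R[i]).
Local Notation C := R[i].
Variables (H : pop F F) (c : R).
Hypothesis cH : forall x, pdom H x -> c * nrm x ^+ 2 <= complex.Re (hdot (H x) x).

(** In [H - mu = (H - c) + (c - mu)] both summands are nonnegative, so the cross term only helps.
    The first bound has constants independent of [mu]; in the second, [c - mu] can be made large. *)
Lemma shift_sub_bounds (mu : R) x : pdom H x -> mu <= c ->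
  nrm (H x) <= nrm (shift_sub H mu x) + `|c| * nrm x /\
  (c - mu) * nrm x <= nrm (shift_sub H mu x).
Proof.
move=> Hx muc; split; last first.
  by apply: coercive_bound; exact: shift_sub_lower.
suff h : nrm (H x - c%:C *: x) <= nrm (shift_sub H mu x).
  have := nrmD (H x - c%:C *: x) (c%:C *: x).
  by rewrite subrK nrmZ cnrmR; lra.
have -> : shift_sub H mu x = (H x - c%:C *: x) + (c - mu)%:C *: x.
  by rewrite /= rmorphB/= scalerBl addrA subrK.
rewrite -ler_sqr ?nnegrE ?nrm_ge0// [X in _ <= X]nrm2D hdotZr conj_real_complex.
have : 0 <= complex.Re (hdot (H x - c%:C *: x) x).
  by have := shift_sub_lower c cH Hx; rewrite subrr mul0r.
move=> p0; have := sqr_ge0 (nrm ((c - mu)%:C *: x)).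
rewrite ReZ.
have cmu : 0 <= c - mu by rewrite subr_ge0.
by have := mulr_ge0 cmu p0; lra.
Qed.

(** Far enough down, the lower-order terms are absorbed by [(c - mu) |x| <= |(H - mu) x|], at the
    price of any increase of the relative bound. [N] is abstract in order to cover both [S] and
    [A]. *)
Lemma relatively_bounded_shift (N : F -> R) (a b q : R) : 0 <= a -> a < q ->
  (forall x, pdom H x -> N x <= a * nrm (H x) + b * nrm x) ->
  exists2 L : R, L < c & forall mu x, mu <= L -> pdom H x ->
    N x <= q * nrm (shift_sub H mu x).
Proof.
(* Once [c - mu >= k], the term [(a |c| + |b|) |x|] is at most [(q - a) |(H - mu) x|]. The [- 1] in
   the witness makes [L < c] strict. *)
move=> a0 aq NH; pose k := (a * `|c| + `|b|) / (q - a).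
have qa : 0 < q - a by rewrite subr_gt0.
have k0 : 0 <= k.
  by apply: divr_ge0; [rewrite addr_ge0 ?mulr_ge0|exact: ltW].
exists (c - k - 1) => [|mu x muL Hx]; first lra.
have muc : mu <= c by lra.
have [h1 h2] := shift_sub_bounds Hx muc.
have h3 := NH x Hx; have h4 := ler_wpM2l a0 h1.
have h5 := ler_wpM2r (nrm_ge0 x) (ler_norm b).
have h6 : (a * `|c| + `|b|) * nrm x <= (q - a) * nrm (shift_sub H mu x).
  rewrite -[a * _ + _](@divfK _ (q - a)) ?gt_eqF// -/k.
  rewrite mulrAC mulrC ler_pM2l//.
  rewrite (le_trans _ h2)// ler_wpM2r ?nrm_ge0//; lra.
by move: h3 h4 h5 h6; lra.
Qed.

End RelativeBound.

(** * Infinitesimal boundedness from the functional calculus *)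

Section FunctionalCalculusBound.
Variables (R : realType) (F : hilbertType R[i]).
Local Notation C := R[i].

(** Beyond the threshold [B = d^(-1/(1-s))] one has [u^(s-1) <= d]; up to it, [u^s <= u <= B]
    because [1 <= u]. *)
Lemma powR_le_affine (s d : R) : 0 < s -> s < 1 -> 0 < d ->
  exists2 K, 0 <= K & forall u, 1 <= u -> u `^ s <= d * u + K.
Proof.
move=> s0 s1 d0; pose r := 1 - s; have r0 : 0 < r by rewrite subr_gt0.
pose B := d `^ (- r^-1); have B0 : 0 <= B := powR_ge0 _ _.
exists B => // u u1; have u0 : 0 < u by rewrite (lt_le_trans _ u1).
have [uB|/ltW uB] := leP u B.
  rewrite (le_trans (ler1_powR u1 (ltW s1)))// (le_trans uB)//.
  by rewrite lerDr mulr_ge0// ltW.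
suff : u `^ s <= d * u by move=> /le_trans; apply; rewrite lerDl.
have Br : 1 <= u `^ r * d.
  have : B `^ r <= u `^ r by rewrite ge0_ler_powR ?nnegrE// ltW.
  rewrite /B -powRrM mulNr mulVf ?gt_eqF// powR_inv1; last exact: ltW.
  by rewrite -[d^-1]div1r ler_pdivrMr.
rewrite -[leLHS]mulr1 (le_trans (ler_wpM2l (powR_ge0 _ _) Br))//.
rewrite mulrA -powRD; last by rewrite (gt_eqF u0) implybT.
by rewrite /r addrCA subrr addr0 powRr1 1?mulrC// ltW.
Qed.

Lemma spectral_measureT (E : pvm F) x :
  spectral_measure E x setT = (nrm x ^+ 2)%:E.
Proof. by rewrite /spectral_measure pvmT nrmE -rmorphXn. Qed.

(** The scalar inequality for [t^2 + 1], integrated against the spectral measure of [x], of total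
    mass [|x|^2], gives [|T x|^2 <= e^2 |H x|^2 + (e^2 + K) |x|^2], and with it dom(H) is contained
    in dom(T). *)
Lemma functional_calculus_power_bound (H T : linop F F) (s e : R) :
  0 < s -> s < 1 -> 0 < e ->
  functional_calculus H (fun t => (t ^+ 2 + 1) `^ (s / 2)) T ->
  exists2 K : R, 0 <= K & forall x, pdom H x ->
    nrm (T x) <= e * nrm (H x) + K * nrm x.
Proof.
move=> s0 s1 e0 [E [HE TE]].
have e20 : 0 < e ^+ 2 by rewrite exprn_gt0.
have [K K0 KP] := powR_le_affine s0 s1 e20.
exists (Num.sqrt (e ^+ 2 + K)); first exact: sqrtr_ge0.
move=> x Hx; pose m := spectral_measure E x.
pose g (t : R) := ((t ^+ 2 + 1) `^ (s / 2)) ^+ 2.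
have gE t : g t <= e ^+ 2 * t ^+ 2 + (e ^+ 2 + K).
  have t1 : 1 <= t ^+ 2 + 1 by rewrite lerDr sqr_ge0.
  rewrite /g -powR_mulrn ?powR_ge0// -powRrM divfK ?gt_eqF//.
  by have := KP _ t1; lra.
have mg : measurable_fun [set: R] g.
  apply: measurable_funX; apply: (measurableT_comp (measurable_powR _)).
  by apply: measurable_funD => //; exact: exprn_measurable.
have Hfin : (\int[m]_t (t ^+ 2)%:E < +oo)%E.
  by move: Hx; rewrite (si_dom HE).
have t20 (t : R) : (0 <= (t ^+ 2)%:E)%E by rewrite lee_fin sqr_ge0.
have mt2 : measurable_fun [set: R] (fun t : R => (t ^+ 2)%:E).
  by apply/measurable_EFinP; exact: exprn_measurable.
(* The real-valued integral in [si_norm] is 0 when the extended one is infinite; finiteness, known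
   from the domain, identifies the two. *)
have intH : (\int[m]_t (t ^+ 2)%:E)%E = (nrm (H x) ^+ 2)%:E.
  have := si_norm HE Hx; rewrite nrmE -rmorphXn/= => /complexI ->.
  by rewrite /Rintegral fineK// ge0_fin_numE// integral_ge0.
have gle : (\int[m]_t (g t)%:E <=
    (e ^+ 2 * nrm (H x) ^+ 2 + (e ^+ 2 + K) * nrm x ^+ 2)%:E)%E.
  apply: (@le_trans _ _
    (\int[m]_t ((e ^+ 2)%:E * (t ^+ 2)%:E + (e ^+ 2 + K)%:E))%E).
    apply: ge0_le_integral => //.
    - by move=> t _; rewrite lee_fin sqr_ge0.
    - by apply/measurable_EFinP.
    - by apply: emeasurable_funD => //; exact: measurable_funeM.
    - by move=> t _; rewrite -EFinM -EFinD lee_fin gE.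
  rewrite ge0_integralD//=; last 3 first.
  - by move=> t _; rewrite -EFinM lee_fin mulr_ge0 ?sqr_ge0.
  - exact: measurable_funeM.
  - by move=> t _; rewrite lee_fin addr_ge0// ltW.
  rewrite ge0_integralZl_EFin//; last exact: ltW.
  by rewrite intH integral_cst//= spectral_measureT -!EFinM -EFinD.
have gfin : (\int[m]_t (g t)%:E < +oo)%E by rewrite (le_lt_trans gle)// ltry.
have Tx : pdom T x by rewrite (si_dom TE).
have intT : (\int[m]_t (g t)%:E)%E = (nrm (T x) ^+ 2)%:E.
  have := si_norm TE Tx; rewrite nrmE -rmorphXn/= => /complexI ->.
  rewrite /Rintegral fineK// ge0_fin_numE//; apply: integral_ge0 => t _.
  by rewrite lee_fin sqr_ge0.
move: gle; rewrite intT lee_fin => h.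
have k0 : 0 <= e ^+ 2 + K by rewrite addr_ge0// ltW.
have := sqr_sqrtr k0; set k := Num.sqrt _ => kE.
have kx : 0 <= k * nrm x by rewrite mulr_ge0 ?sqrtr_ge0 ?nrm_ge0.
have ex : 0 <= e * nrm (H x) by rewrite mulr_ge0 ?nrm_ge0// ltW.
rewrite -ler_sqr ?nnegrE ?nrm_ge0 ?addr_ge0//.
rewrite (le_trans h)// -kE sqrrD !exprMn.
by have := mulr_ge0 ex kx; lra.
Qed.

Lemma bounded_on_Hs_infinitesimal (H : linop F F)
    (A : {linear domain_space H -> F}) (s e : R) :
  0 < s -> s < 1 -> 0 < e -> bounded_on_Hs A s ->
  exists2 K : R, 0 <= K & forall x : domain_space H,
    nrm (A x) <= e * nrm (H (dval x)) + K * nrm (dval x).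
Proof.
move=> s0 s1 e0 [T [HT [M AM]]].
(* [+ 1] keeps the divisor positive when [M = 0]. *)
have M1 : 0 < cnrm M + 1 by have := cnrm_ge0 M; lra.
have eM : 0 < e / (cnrm M + 1) by rewrite divr_gt0.
have [K K0 KP] := functional_calculus_power_bound s0 s1 eM HT.
exists ((cnrm M + 1) * K); first by rewrite mulr_ge0// ltW.
move=> x; have := KP _ (pdom_dval x) => h.
have Ax : nrm (A x) <= cnrm M * nrm (T (dval x)).
  rewrite -lecR real_complexM -!nrmE -cnrmE.
  have Mx0 : 0 <= M * `|T (dval x)| by exact: le_trans (AM x).
  by rewrite (le_trans (AM x))// -(ger0_norm Mx0) normrM normr_id.
have := ler_wpM2l (ltW M1) h; rewrite mulrDr mulrA mulrCA divff ?gt_eqF//.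
by have := nrm_ge0 (T (dval x)); lra.
Qed.

End FunctionalCalculusBound.

(** * The spaces H_1 and H_{-1} *)

Section DomainSpaceTheory.
Variables (R : realType) (F : hilbertType R[i]) (H : linop F F).
Local Notation C := R[i].
Local Notation H1 := (domain_space H).
Local Notation Hm1 := (antidual (domain_space H)).

Lemma to_H1K x : pdom H x -> dval (to_H1 H x) = x.
Proof. by move=> Hx; apply: insubdK; exact: mem_set. Qed.

Lemma dvalK (y : H1) : to_H1 H (dval y) = y.
Proof. by apply: val_inj; apply: to_H1K; exact: pdom_dval. Qed.

Lemma dval_inj (x y : H1) : dval x = dval y -> x = y.
Proof. exact: val_inj. Qed.

Lemma dvalN (x : H1) : dval (- x) = - dval x.
Proof. exact: (raddfN (val : domain_space H -> F)). Qed.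

Lemma dvalB (x y : H1) : dval (x - y) = dval x - dval y.
Proof. by rewrite dvalD dvalN. Qed.

Lemma pdom_linear (a : C) x y : pdom H x -> pdom H y -> pdom H (a *: x + y).
Proof. by have [_ + _] := linopP H; apply. Qed.

Lemma linop_linear (a : C) x y : pdom H x -> pdom H y ->
  H (a *: x + y) = a *: H x + H y.
Proof. by have [_ _] := linopP H; apply. Qed.

Lemma pdom0 : pdom H 0.
Proof. by have [] := linopP H. Qed.

Lemma pdomD x y : pdom H x -> pdom H y -> pdom H (x + y).
Proof. by move=> Hx Hy; have [] := linopD (linopP H) Hx Hy. Qed.

Lemma pdomB x y : pdom H x -> pdom H y -> pdom H (x - y).
Proof. by move=> Hx Hy; have [] := linopB (linopP H) Hx Hy. Qed.

Lemma pdomZ (a : C) x : pdom H x -> pdom H (a *: x).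
Proof. by move=> Hx; have [] := linopZ a (linopP H) Hx. Qed.

Lemma linop_B x y : pdom H x -> pdom H y -> H (x - y) = H x - H y.
Proof. by move=> Hx Hy; have [] := linopB (linopP H) Hx Hy. Qed.

Lemma to_H1_linear (a : C) x y : pdom H x -> pdom H y ->
  to_H1 H (a *: x + y) = a *: to_H1 H x + to_H1 H y.
Proof.
move=> Hx Hy; apply: dval_inj; rewrite dvalD dvalZ !to_H1K//.
exact: pdom_linear.
Qed.

Lemma nrm_domain (y : H1) :
  [/\ nrm (dval y) <= nrm y, nrm (H (dval y)) <= nrm y
    & nrm y <= nrm (dval y) + nrm (H (dval y))].
Proof.
have E : nrm y ^+ 2 = nrm (dval y) ^+ 2 + nrm (H (dval y)) ^+ 2.
  apply: (@complexI R); rewrite real_complexD !rmorphXn/= -!nrmE.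
  by rewrite -[`|y|]/(domain_norm y) sqrtCK.
have p := nrm_ge0 (dval y); have q := nrm_ge0 (H (dval y)); have r := nrm_ge0 y.
split; rewrite -ler_sqr ?nnegrE ?addr_ge0// E.
- by rewrite lerDl sqr_ge0.
- by rewrite lerDr sqr_ge0.
- by rewrite sqrrD; have := mulr_ge0 p q; lra.
Qed.

Lemma antidual_intro (l : H1 -> C) (M : R) :
  (forall (a : C) x y, l (a *: x + y) = a^* * l x + l y) ->
  (forall x, cnrm (l x) <= M * nrm x) -> l \in @is_antidual R H1.
Proof.
move=> lL lM; apply/asboolP; split=> //; exists M%:C => x.
by rewrite cnrmE nrmE -real_complexM lecR.
Qed.

Lemma antidual_ext (l m : Hm1) : (forall y, l y = m y) -> l = m.
Proof. by move=> lm; apply: val_inj; apply/funext. Qed.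

Lemma antidualE (a : C) (l m : Hm1) y : (a *: l + m) y = a * l y + m y.
Proof. by []. Qed.

Lemma antidualD (l m : Hm1) y : (l + m) y = l y + m y.
Proof. by []. Qed.

Lemma antidualB (l m : Hm1) y : (l - m) y = l y - m y.
Proof. by []. Qed.

Lemma antidual_linear (l : Hm1) (a : C) x y :
  l (a *: x + y) = a^* * l x + l y.
Proof. by have /asboolP[lL _] := avalP l; exact: lL. Qed.

Lemma antidual_bound (l : Hm1) y : cnrm (l y) <= nrm l * nrm y.
Proof.
by rewrite -lecR real_complexM -!nrmE -cnrmE; exact: antidual_normP.
Qed.

Lemma nrm_antidual_le (l : Hm1) (M : R) : 0 <= M ->
  (forall y, cnrm (l y) <= M * nrm y) -> nrm l <= M.
Proof.
move=> M0 lM; rewrite -lecR -nrmE -[`|l|]/(antidual_norm l) lecR.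
apply: ge_sup; first by exists (complex.Re `|l 0|), 0 => //=; rewrite normr0.
move=> _ [y /= y1 <-]; apply: (le_trans (lM y)).
by apply: ler_piMr => //; rewrite -lecR -nrmE.
Qed.

Lemma to_Hm1E x (y : H1) : to_Hm1 H x y = hdot x (dval y).
Proof.
rewrite /to_Hm1 -[aval _]/(val _) insubdK//.
apply: (@antidual_intro _ (nrm x)) => [a u v|u].
  by rewrite dvalD dvalZ hdotDr hdotZr.
rewrite (le_trans (cauchy_schwarz _ _))// ler_wpM2l ?nrm_ge0//.
by have [] := nrm_domain u.
Qed.

Lemma to_Hm1_bounded : bounded_linear (to_Hm1 H).
Proof.
apply/bounded_linearP; split=> [a x y|].
  by apply: antidual_ext => v; rewrite antidualE !to_Hm1E hdotDl hdotZl.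
exists 1 => // x; rewrite mul1r; apply: nrm_antidual_le => [|y].
  exact: nrm_ge0.
rewrite to_Hm1E (le_trans (cauchy_schwarz _ _))// ler_wpM2l ?nrm_ge0//.
by have [] := nrm_domain y.
Qed.

Lemma to_Hm1B x y : to_Hm1 H (x - y) = to_Hm1 H x - to_Hm1 H y.
Proof. by have [lH _] := to_Hm1_bounded; exact: linear_sub. Qed.

Hypothesis dH : dense (pdom H).

Lemma to_Hm1_inj : injective (to_Hm1 H).
Proof.
move=> x y xy; apply/eqP; rewrite -subr_eq0; apply/eqP.
apply: (dense_orth dH) => v Hv; rewrite hdotC hdotDl hdotNl -(to_H1K Hv).
by rewrite -!to_Hm1E xy subrr rmorph0.
Qed.

Lemma to_Hm1K x : of_Hm1 (to_Hm1 H x) = x.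
Proof.
by rewrite /of_Hm1; case: xgetP => [y _ /to_Hm1_inj//|/(_ x)/(_ erefl)].
Qed.

Hypothesis sH : symmetric_op H.

(** As [Hbar] is chosen by its specification, two facts are needed: a bounded extension exists,
    namely [u] sent to the functional [<u, H .>], and every bounded extension agrees with it by
    density of dom(H). *)
Lemma HbarE x (y : H1) : Hbar H x y = hdot x (H (dval y)).
Proof.
have dd := proj1 (denseE _) dH.
suff [bL LE] : bounded_linear (Hbar H) /\
    forall x : H1, Hbar H (dval x) = to_Hm1 H (H (dval x)).
  have [lL [M M0 LM]] := proj1 (bounded_linearP _) bL.
  apply/eqP; rewrite -subr_eq0 -normr_le0 cnrmE lecR.
  apply/ler_addgt0Pr => e e0; rewrite add0r.
  (* Approximating [x] by [v] in dom(H) leaves an error of at most [k |x - v|]; [+ 1] makes [k]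
     positive. *)
  pose k := M * nrm y + nrm (H (dval y)) + 1.
  have k0 : 0 < k.
    have := mulr_ge0 M0 (nrm_ge0 y); have := nrm_ge0 (H (dval y)).
    by rewrite /k; lra.
  have [v Hv xv] := dd x _ (divr_gt0 e0 k0).
  have -> : Hbar H x y - hdot x (H (dval y)) =
      Hbar H (x - v) y + - hdot (x - v) (H (dval y)).
    have Ev : Hbar H v = to_Hm1 H (H v) by rewrite -{1}(to_H1K Hv) LE to_H1K.
    rewrite linear_sub// antidualB Ev to_Hm1E.
    by rewrite sH//; [rewrite hdotDl hdotNl; ring|exact: pdom_dval].
  rewrite (le_trans (cnrmD _ _))// -hdotNl opprB.
  have := antidual_bound (Hbar H (x - v)) y.
  have := ler_wpM2r (nrm_ge0 y) (LM (x - v)).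
  have := cauchy_schwarz (v - x) (H (dval y)); rewrite nrmBC.
  move: xv; rewrite ltr_pdivlMr// /k; have := nrm_ge0 (x - v); lra.
have exH u : exists l : Hm1, forall v, l v = hdot u (H (dval v)).
  have P : (fun v : H1 => hdot u (H (dval v))) \in @is_antidual R H1.
    apply: (@antidual_intro _ (nrm u)) => [a v w|v].
      rewrite dvalD dvalZ linop_linear ?hdotDr ?hdotZr//; exact: pdom_dval.
    rewrite (le_trans (cauchy_schwarz _ _))// ler_wpM2l ?nrm_ge0//.
    by have [] := nrm_domain v.
  by exists (Antidual P).
have /choice[L LP] := exH.
suff : [set L | bounded_linear L /\
    forall x : H1, L (dval x) = to_Hm1 H (H (dval x))] L.
  by rewrite /Hbar => h; case: xgetP => [? _ //|/(_ L)].
split=> [|v]; last first.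
  apply: antidual_ext => w; rewrite LP to_Hm1E sH//; exact: pdom_dval.
apply/bounded_linearP; split=> [a u v|].
  by apply: antidual_ext => w; rewrite antidualE !LP hdotDl hdotZl.
exists 1 => // u; rewrite mul1r; apply: nrm_antidual_le => [|v].
  exact: nrm_ge0.
rewrite LP (le_trans (cauchy_schwarz _ _))// ler_wpM2l ?nrm_ge0//.
by have [] := nrm_domain v.
Qed.

Lemma Hbar_bounded : bounded_linear (Hbar H).
Proof.
apply/bounded_linearP; split=> [a u v|].
  by apply: antidual_ext => w; rewrite antidualE !HbarE hdotDl hdotZl.
exists 1 => // u; rewrite mul1r; apply: nrm_antidual_le => [|v].
  exact: nrm_ge0.
rewrite HbarE (le_trans (cauchy_schwarz _ _))// ler_wpM2l ?nrm_ge0//.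
by have [] := nrm_domain v.
Qed.

Variable A : {linear H1 -> F}.
Variable K : R.
Hypothesis K0 : 0 <= K.
Hypothesis AK : forall x : H1, nrm (A x) <= K * nrm x.

Lemma A_adjE x (y : H1) : A_adj A x y = hdot x (A y).
Proof.
have P : (fun v : H1 => hdot x (A v)) \in @is_antidual R H1.
  apply: (@antidual_intro _ (nrm x * K)) => [a v w|v].
    by rewrite linearP hdotDr hdotZr.
  by rewrite (le_trans (cauchy_schwarz _ _))// -mulrA ler_wpM2l ?nrm_ge0.
rewrite /A_adj (@adjoint_unique _ _ _ _ _ _ _ _ _ (Antidual P))//.
  by move=> v; rewrite /pair_1_m1/= hdotC.
move=> l lP; apply: antidual_ext => v.
by rewrite -[l v]conjCK -[RHS]conjCK; congr (_^*); exact: lP.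
Qed.

Lemma A_adj_bounded : bounded_linear (A_adj A).
Proof.
apply/bounded_linearP; split=> [a u v|].
  by apply: antidual_ext => w; rewrite antidualE !A_adjE hdotDl hdotZl.
exists K => // u; apply: nrm_antidual_le => [|v].
  by rewrite mulr_ge0// nrm_ge0.
rewrite A_adjE (le_trans (cauchy_schwarz _ _))//.
by rewrite [K * _]mulrC -mulrA ler_wpM2l// nrm_ge0.
Qed.

End DomainSpaceTheory.

(** * The operators G_z and H_S *)

Section WeylFunction.
Variables (R : realType) (F : hilbertType R[i]) (H : linop F F).
Local Notation C := R[i].
Local Notation H1 := (domain_space H).
Local Notation Hm1 := (antidual (domain_space H)).
Hypothesis H_sa : self_adjoint H.
Implicit Types (x y : F) (z w : C).

Let dH : dense (pdom H). Proof. by have [_ dH _ _] := self_adjointP H_sa. Qed.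
Let sH : symmetric_op H. Proof. by have [_ _ sH _] := self_adjointP H_sa. Qed.

Lemma Rz_dom z x : resolvent_set H z -> pdom H (Rz H z x).
Proof. exact: resolvent_dom. Qed.

Lemma Rz_bounded z : resolvent_set H z -> bounded_linear (Rz H z).
Proof. exact: resolvent_bounded. Qed.

Lemma HRz z x : resolvent_set H z -> H (Rz H z x) = z *: Rz H z x - x.
Proof. exact: resolvent_app. Qed.

Lemma RzK z x : resolvent_set H z -> pdom H x -> Rz H z (- H x + z *: x) = x.
Proof. exact: resolventK. Qed.

Lemma Rz_adj z x y : resolvent_set H z ->
  hdot (Rz H z x) y = hdot x (Rz H z^* y).
Proof. exact: resolvent_adj. Qed.

Lemma Rz_adjr z x y : resolvent_set H z ->
  hdot (Rz H z^* x) y = hdot x (Rz H z y).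
Proof.
move=> zH; rewrite Rz_adj ?conjCK//.
exact: resolvent_set_conj.
Qed.

Lemma resolvent_identity z w x : resolvent_set H z -> resolvent_set H w ->
  Rz H z x - Rz H w x = (w - z) *: Rz H w (Rz H z x).
Proof.
move=> zH wH; have [lR _] := Rz_bounded wH.
have {2}-> : x = (- H (Rz H z x) + w *: Rz H z x) + (z - w) *: Rz H z x.
  rewrite HRz// opprD opprK scalerBl -addrA [w *: _ + _]addrC subrK.
  by rewrite addrAC addNr add0r.
rewrite linear_addl// RzK//; last exact: Rz_dom.
by rewrite linear_scale// opprD addrA subrr add0r -scaleNr opprB.
Qed.

(** Following the resolvent by an [H]-bounded map, linear on dom(H) alone, gives a bounded operator
    on F; serves for [S], [A] and [H] itself. *)
Lemma relatively_bounded_Rz (V : normedModType C) (N : F -> V) (a b : R) z :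
  0 <= a -> 0 <= b ->
  (forall (k : C) x y, pdom H x -> pdom H y -> N (k *: x + y) = k *: N x + N y) ->
  (forall x, pdom H x -> nrm (N x) <= a * nrm (H x) + b * nrm x) ->
  resolvent_set H z -> bounded_linear (fun x => N (Rz H z x)).
Proof.
move=> a0 b0 NL NB zH; have /bounded_linearP[lR [M M0 RM]] := Rz_bounded zH.
apply/bounded_linearP; split=> [k x y|]; first by rewrite lR NL//; exact: Rz_dom.
exists (a * (cnrm z * M + 1) + b * M) => [|x].
  by rewrite addr_ge0 ?mulr_ge0 ?addr_ge0 ?mulr_ge0 ?cnrm_ge0.
have h := NB _ (Rz_dom x zH).
have h1 : nrm (H (Rz H z x)) <= (cnrm z * M + 1) * nrm x.
  rewrite HRz// (le_trans (nrmB _ _))// nrmZ mulrDl mul1r lerD2r.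
  by rewrite -mulrA ler_wpM2l ?cnrm_ge0.
have := ler_wpM2l a0 h1; have := ler_wpM2l b0 (RM x); move: h; lra.
Qed.

Variable A : {linear H1 -> F}.
Variables a b : R.
Hypotheses (a0 : 0 <= a) (b0 : 0 <= b).
Hypothesis A_le : forall x : H1,
  nrm (A x) <= a * nrm (H (dval x)) + b * nrm (dval x).

(** [A] as a map on [F]; the default of [to_H1] makes it 0 outside dom(H). *)
Definition At x := A (to_H1 H x).

Lemma AtE (y : H1) : At (dval y) = A y.
Proof. by rewrite /At dvalK. Qed.

Lemma At_linear (k : C) x y : pdom H x -> pdom H y ->
  At (k *: x + y) = k *: At x + At y.
Proof. by move=> Hx Hy; rewrite /At to_H1_linear// linearP. Qed.

Lemma AtD x y : pdom H x -> pdom H y -> At (x + y) = At x + At y.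
Proof. by move=> Hx Hy; rewrite -[x]scale1r At_linear// !scale1r. Qed.

Lemma At0 : At 0 = 0.
Proof.
by rewrite /At (_ : to_H1 H 0 = 0) ?linear0// -(dval0 H) dvalK.
Qed.

Lemma AtZ (k : C) x : pdom H x -> At (k *: x) = k *: At x.
Proof.
by move=> Hx; rewrite -[k *: x]addr0 At_linear ?At0 ?addr0//; exact: pdom0.
Qed.

Lemma AtB x y : pdom H x -> pdom H y -> At (x - y) = At x - At y.
Proof.
move=> Hx Hy; rewrite -scaleN1r AtD ?AtZ ?scaleN1r//.
by rewrite -scaleN1r; exact: pdomZ.
Qed.

Lemma At_le x : pdom H x -> nrm (At x) <= a * nrm (H x) + b * nrm x.
Proof. by move=> Hx; have := A_le (to_H1 H x); rewrite to_H1K. Qed.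

Lemma A_bounded_H1 (y : H1) : nrm (A y) <= (a + b) * nrm y.
Proof.
have [h1 h2 _] := nrm_domain y; rewrite (le_trans (A_le y))// mulrDl.
by apply: lerD; apply: ler_wpM2l.
Qed.

Lemma ARz_bounded z : resolvent_set H z -> bounded_linear (fun x => At (Rz H z x)).
Proof.
by apply: (relatively_bounded_Rz a0 b0) => [k x y|x];
  [exact: At_linear|exact: At_le].
Qed.

Lemma GzE z x y : resolvent_set H z ->
  hdot (At (Rz H z^* x)) y = hdot x (Gz A z y).
Proof.
move=> zH; apply: (@adjE _ _ (fun x => At (Rz H z^* x))).
by apply: ARz_bounded; exact: resolvent_set_conj.
Qed.

Lemma GzEl z x y : resolvent_set H z ->
  hdot (Gz A z x) y = hdot x (At (Rz H z^* y)).
Proof. by move=> zH; rewrite hdotC -GzE// -hdotC. Qed.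

Lemma Gz_bounded z : resolvent_set H z -> bounded_linear (Gz A z).
Proof.
move=> zH; apply: (@adj_bounded _ _ (fun x => At (Rz H z^* x))).
by apply: ARz_bounded; exact: resolvent_set_conj.
Qed.

Lemma Gz_linear z : resolvent_set H z -> linear (Gz A z).
Proof. by move=> /Gz_bounded[]. Qed.

Lemma At_Gz z x y : resolvent_set H z -> pdom H x ->
  hdot (At x) y = hdot (- H x + z^* *: x) (Gz A z y).
Proof.
move=> zH Hx; rewrite -GzE// RzK//.
exact: resolvent_set_conj.
Qed.

(** The adjoint of the resolvent identity preceded by [A]; its right-hand side shows that the
    singular parts at different energies agree modulo dom(H). *)
Lemma Gz_identity z w x : resolvent_set H z -> resolvent_set H w ->
  Gz A z x - Gz A w x = (w - z) *: Rz H z (Gz A w x).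
Proof.
move=> zH wH; apply: hdot_inj => v.
have zcH := resolvent_set_conj H_sa zH; have wcH := resolvent_set_conj H_sa wH.
rewrite hdotDr hdotNr -!GzE// -hdotNl -hdotDl -AtB; [|exact: Rz_dom..].
rewrite resolvent_identity// AtZ; last exact: Rz_dom.
by rewrite hdotZl hdotZr GzE// Rz_adjr// conjD conjN.
Qed.

Lemma Gz_sub_dom z w x : resolvent_set H z -> resolvent_set H w ->
  pdom H (Gz A z x - Gz A w x).
Proof. by move=> zH wH; rewrite Gz_identity//; apply/pdomZ/Rz_dom. Qed.

Lemma domD_change z w x : resolvent_set H z -> resolvent_set H w ->
  pdom H (x - Gz A w x) -> pdom H (x - Gz A z x).
Proof.
move=> zH wH Hx.
have -> : x - Gz A z x = (x - Gz A w x) + (Gz A w x - Gz A z x).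
  by rewrite addrA subrK.
by apply: pdomD => //; exact: Gz_sub_dom.
Qed.

(* [Hbar x + A_adj x] as a vector of [F]. *)
Definition HAadj z x := H (x - Gz A z x) + z *: Gz A z x.

(** Tested against [y] in dom(H), [A_adj x] gives [- <G_z x, H y> + z <G_z x, y>]. Its first term
    completes [<x, H y>] to [<x - G_z x, H y>], where [H] may change sides. *)
Lemma HAadjE z x : resolvent_set H z -> pdom H (x - Gz A z x) ->
  to_Hm1 H (HAadj z x) = Hbar H x + A_adj A x.
Proof.
move=> zH Hx; apply: antidual_ext => y.
rewrite antidualD to_Hm1E HbarE// (A_adjE A_bounded_H1) -AtE.
have Hy := pdom_dval y.
rewrite [hdot x (At _)]hdotC (At_Gz _ zH Hy) -hdotC.
rewrite /HAadj hdotDl sH// !hdotE conjCK.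
ring.
Qed.

(** Both vectors represent the functional [Hbar x + A_adj x], which involves no energy. *)
Lemma HAadj_change z w x : resolvent_set H z -> resolvent_set H w ->
  pdom H (x - Gz A w x) -> HAadj z x = HAadj w x.
Proof.
move=> zH wH Hx; apply: (to_Hm1_inj dH).
by rewrite !HAadjE//; exact: domD_change Hx.
Qed.

Variable S : linop F F.
Hypothesis S_sym : symmetric_op S.
Hypothesis S_dom : pdom H `<=` pdom S.

Lemma S_linear (k : C) x y : pdom H x -> pdom H y ->
  S (k *: x + y) = k *: S x + S y.
Proof. by move=> Hx Hy; rewrite linop_linear//; exact: S_dom. Qed.

Section FixedEnergy.
Variable l : R.
Hypothesis lH : resolvent_set H l%:C.
Local Notation G := (Gz A l%:C).

Lemma H_SE x : domD A l x -> H_S S A l x = HAadj l%:C x + A_S S A l x.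
Proof.
by move=> Dx; rewrite /H_S/= -(HAadjE lH Dx) to_Hm1K.
Qed.

Lemma H_S_factor x y : domD A l x ->
  hdot (H_S S A l x) y = l%:C * hdot x y +
    hdot (H (x - G x) - l%:C *: (x - G x) - S (x - G x)) (y - G y).
Proof.
move=> Dx; rewrite H_SE// /HAadj /A_S /T_S -/(At _).
set x0 := x - G x.
have adjG f : hdot (G_adj A l f) y = hdot f (G y).
  by rewrite adjEr//; exact: Gz_bounded.
rewrite !(hdotDl, hdotNl) (At_Gz _ lH Dx) adjG -/x0 conj_real_complex.
move: (H x0) (S x0) => hx sx; rewrite /x0 !hdotE.
ring.
Qed.

Definition H_sub_S x := H x - l%:C *: x - S x.

Lemma H_sub_S_linop : is_linop (Pop (pdom H) H_sub_S).
Proof.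
split=> [|k x y|k x y Hx Hy] /=; [exact: pdom0|exact: pdom_linear|].
rewrite /H_sub_S linop_linear// S_linear//.
move: (H x) (H y) (S x) (S y) => hx hy sx sy.
rewrite !scalerBr !scalerDr !scalerA [l%:C * k]mulrC.
by rewrite !opprD [k *: hx + hy + _]addrACA [LHS]addrACA.
Qed.

Lemma H_sub_S_symmetric : symmetric_op (Pop (pdom H) H_sub_S).
Proof.
move=> x y Hx Hy; rewrite /= /H_sub_S !hdotE conj_real_complex sH//.
by rewrite S_sym//; exact: S_dom.
Qed.

Lemma G_adjE x y : hdot (G_adj A l x) y = hdot x (G y).
Proof. by rewrite adjEr//; exact: Gz_bounded. Qed.

Lemma G_adj_bounded : bounded_linear (G_adj A l).
Proof. by apply: adj_bounded; exact: Gz_bounded. Qed.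

Lemma H_S_formula x : domD A l x ->
  H_S S A l x = l%:C *: x + (H_sub_S (x - G x) - G_adj A l (H_sub_S (x - G x))).
Proof.
move=> Dx; apply: hdot_inj => y; rewrite hdotC [RHS]hdotC; congr (_^*).
rewrite H_S_factor// -/(H_sub_S _); move: (H_sub_S _) => n.
by rewrite hdotDl hdotZl hdotDl hdotNl G_adjE hdotDr hdotNr.
Qed.

Lemma H_S_symmetric : symmetric_op (H_S S A l).
Proof.
move=> x y Dx Dy.
rewrite [RHS]hdotC !H_S_factor// conjD conjM conj_real_complex -!hdotC.
by congr (_ + _); exact: H_sub_S_symmetric.
Qed.

Lemma one_sub_G_linear (k : C) x y :
  (k *: x + y) - G (k *: x + y) = k *: (x - G x) + (y - G y).
Proof. by rewrite Gz_linear// scalerBr opprD addrACA. Qed.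

Lemma H_S_linop : is_linop (H_S S A l).
Proof.
have Dlin (k : C) x y : domD A l x -> domD A l y -> domD A l (k *: x + y).
  by move=> Dx Dy; rewrite /domD/= one_sub_G_linear; exact: pdom_linear.
have [_ _ NL] := H_sub_S_linop.
split=> [|//|k x y Dx Dy].
  rewrite /H_S/domD/= linear_zero ?subr0; [exact: pdom0|exact: Gz_linear].
have [lG _] := G_adj_bounded.
rewrite !H_S_formula//; last exact: Dlin.
rewrite one_sub_G_linear (NL k _ _ Dx Dy : H_sub_S _ = k *: H_sub_S _ + H_sub_S _).
rewrite lG.
move: (H_sub_S (x - G x)) (H_sub_S (y - G y)) => nx ny.
rewrite !scalerDr !scalerN opprD !scalerA [l%:C * k]mulrC.
by rewrite [k *: nx + ny + _]addrACA [LHS]addrACA.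
Qed.

(** * Self-adjointness and lower bound at an energy where [G] is a contraction *)

Section LowEnergy.
Variables (c q : R).
Hypothesis lc : l < c.
Hypothesis cH : forall x, pdom H x -> c * nrm x ^+ 2 <= complex.Re (hdot (H x) x).
Hypotheses (q0 : 0 <= q) (q1 : q < 1).
Hypothesis S_q : forall x, pdom H x -> nrm (S x) <= q * nrm (H x - l%:C *: x).
Hypothesis A_q : forall x, pdom H x -> nrm (At x) <= q * nrm (H x - l%:C *: x).

(** [G] is the adjoint of [A R_l], and [|A R_l f| <= q |(H - l) R_l f| = q |f|]. *)
Lemma Gz_contraction x : nrm (G x) <= q * nrm x.
Proof.
apply: (@adj_bound _ _ (fun x => At (Rz H l%:C^* x))) => [|y].
  by apply: ARz_bounded; exact: resolvent_set_conj.
rewrite conj_real_complex (le_trans (A_q (Rz_dom _ lH)))// HRz//.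
by rewrite addrAC subrr add0r nrmN.
Qed.

Lemma H_lower x : pdom H x ->
  (c - l) * nrm x <= nrm (H x - l%:C *: x) /\
  (c - l) * nrm x ^+ 2 <= complex.Re (hdot (H x - l%:C *: x) x).
Proof.
move=> Hx; have h := shift_sub_lower l cH Hx.
by split=> //; exact: coercive_bound h.
Qed.

Lemma H_sub_S_surjective f : exists2 x, pdom H x & H_sub_S x = f.
Proof.
have HR x : H (Rz H l%:C x) - l%:C *: Rz H l%:C x = - x.
  by rewrite HRz// addrAC subrr add0r.
have RD := fun x => Rz_dom x lH; have [lR _] := Rz_bounded lH.
(* [R_l] inverts [l - H], so [H - l - S] sends [R_l g] to [- (g - B g)]; hence the target [- f]. *)
pose B x := - S (Rz H l%:C x).
have [|x|g gf] := @contraction_surjective _ _ B q _ q1 _ (- f).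
- by move=> k x y; rewrite /B lR S_linear// scalerN opprD.
- by rewrite /B nrmN (le_trans (S_q (RD x)))// HR nrmN.
exists (Rz H l%:C g) => //; rewrite /H_sub_S HR.
by rewrite -[RHS]opprK -gf /B opprB addrC.
Qed.

(** The form bound leaves at least [(1 - q) <(H - l) x, x>]. *)
Lemma H_sub_S_ge0 x : pdom H x -> 0 <= complex.Re (hdot (H_sub_S x) x).
Proof.
move=> Hx; have cl : 0 < c - l by rewrite subr_gt0.
have h := @form_bound _ _ (shift_sub H l) S (c - l) q
  (shift_sub_linop l (linopP H)) (shift_sub_symmetric sH) S_sym S_dom cl q0
  (fun x Hx => (H_lower Hx).2) (shift_sub_surjective H_sa cH lc) S_q x Hx.
rewrite /H_sub_S hdotDl hdotNl ReD ReN.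
have p0 : 0 <= complex.Re (hdot (shift_sub H l x) x).
  by rewrite (le_trans _ (H_lower Hx).2)// mulr_ge0 ?sqr_ge0// ltW.
have q1' : 0 <= 1 - q by rewrite subr_ge0 ltW.
have := mulr_ge0 q1' p0.
by move: h; rewrite /=; lra.
Qed.

Lemma H_S_low_self_adjoint : self_adjoint (H_S S A l).
Proof.
have bG := Gz_bounded lH; have lG := Gz_linear lH.
pose K := shift_sub (H_S S A l) l.
have V_surj f : exists x, x - G x = f.
  exact: (contraction_surjective lG q1 Gz_contraction).
have V_low x : (1 - q) * nrm x <= nrm (x - G x).
  have := nrm_tri x (G x) 0; rewrite !subr0.
  by have := Gz_contraction x; lra.
have KE x : domD A l x -> K x = H_sub_S (x - G x) - G_adj A l (H_sub_S (x - G x)).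
  move=> Dx; rewrite -[K x]/(H_S S A l x - l%:C *: x) H_S_formula//.
  by rewrite addrAC subrr add0r.
(* The domain is the preimage of dom(H) under [1 - G], which is onto and bounded below and therefore
   pulls dense sets back to dense sets. *)
have dD : dense (domD A l).
  apply/denseE => x e e0.
  have e1 : 0 < (1 - q) * e by rewrite mulr_gt0// subr_gt0.
  have [h Hh xh] := proj1 (denseE _) dH (x - G x) _ e1.
  have [v vh] := V_surj h; exists v; first by rewrite /domD/= vh.
  rewrite -(@ltr_pM2l _ (1 - q)) ?subr_gt0//.
  rewrite (le_lt_trans (V_low _))// (_ : _ - _ = x - G x - h)//.
  by rewrite -vh linear_sub// (opprD (G x)) opprK addrACA [- v + _]addrC opprB.
have sK : symmetric_op K by apply: shift_sub_symmetric; exact: H_S_symmetric.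
have lK : is_linop K by apply: shift_sub_linop; exact: H_S_linop.
have saK : self_adjoint K.
  (* Each of the three factors of [K] is onto; they are solved from the left, beginning with
     [1 - G^*]. *)
  apply: symmetric_surjective_self_adjoint => // f.
  have Gc : forall x, nrm (G_adj A l x) <= q * nrm x.
    by apply: adj_bound => //; exact: Gz_contraction.
  have [g gf] := contraction_surjective (adj_linear bG) q1 Gc f.
  have [h Hh hg] := H_sub_S_surjective g; have [x xh] := V_surj h.
  have Dx : domD A l x by rewrite /domD/= xh.
  by exists x => //; rewrite KE// xh hg.
apply: (@self_adjoint_add_bounded _ _ (H_S S A l) K (fun x => l%:C *: x)) => //.
- by apply/bounded_scale/bounded_id.
- by move=> x _; rewrite -[K x]/(H_S S A l x - l%:C *: x) subrK.
- exact: H_S_symmetric.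
Qed.

Lemma H_S_low_bounded x : domD A l x ->
  l * nrm x ^+ 2 <= complex.Re (hdot (H_S S A l x) x).
Proof.
move=> Dx; rewrite H_S_factor// ReD ReZ -nrm2 lerDl.
exact: H_sub_S_ge0.
Qed.

End LowEnergy.
End FixedEnergy.

(** * Comparison of the operators at two energies *)

Section Comparison.
Variables sa sb : R.
Hypotheses (sa0 : 0 <= sa) (sb0 : 0 <= sb).
Hypothesis S_le : forall x, pdom H x -> nrm (S x) <= sa * nrm (H x) + sb * nrm x.

(** With [E = G_m - G_l], which ranges in dom(H), the operators [A E] and [S E] are bounded. There
    remains [E^* S], with the unbounded factor acting first; symmetry of [S] identifies it on dom(H)
    with the bounded adjoint of [S E]. *)
Lemma H_S_comparison (l m : R) :
  resolvent_set H l%:C -> resolvent_set H m%:C ->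
  exists2 B, bounded_linear B
    & forall x, domD A m x -> H_S S A l x = H_S S A m x + B x.
Proof.
move=> lH mH; pose k : C := l%:C - m%:C.
have RD x := Rz_dom x mH.
pose E x := k *: Rz H m%:C (Gz A l%:C x).
have EE x : Gz A m%:C x - Gz A l%:C x = E x by exact: Gz_identity.
have ED x : pdom H (E x) by exact/pdomZ/RD.
have bSE : bounded_linear (fun x => S (E x)).
  have bSR : bounded_linear (fun x => S (Rz H m%:C x)).
    by apply: (relatively_bounded_Rz sa0 sb0 _ _ mH) => [j x y|x];
      [exact: S_linear|exact: S_le].
  have := bounded_scale k (bounded_comp bSR (Gz_bounded lH)).
  congr bounded_linear; apply/funext => x.
  by rewrite (linopZ _ (linopP S) _).2//; exact/S_dom/RD.
have bAE : bounded_linear (fun x => At (E x)).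
  have := bounded_scale k (bounded_comp (ARz_bounded mH) (Gz_bounded lH)).
  by congr bounded_linear; apply/funext => x; rewrite AtZ//; exact: RD.
pose SE x := S (E x).
have bG := G_adj_bounded mH; have [lG _] := bG.
exists (fun x => At (E x) - (SE x - G_adj A m (SE x)) -
    adj SE (x - Gz A l%:C x)).
  apply: bounded_sub; first apply: bounded_sub => //.
    by apply: bounded_sub => //; exact: bounded_comp bG bSE.
  apply: (bounded_comp (adj_bounded bSE)).
  by apply: bounded_sub; [exact: bounded_id|exact: Gz_bounded].
move=> x Dmx; have Dlx : domD A l x by exact: (domD_change lH mH).
have xE : x - Gz A l%:C x = (x - Gz A m%:C x) + E x.
  by rewrite -EE addrA subrK.
have GE : G_adj A l (S (x - Gz A l%:C x)) =
    G_adj A m (S (x - Gz A l%:C x)) - adj SE (x - Gz A l%:C x).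
  apply: hdot_inj => y; rewrite hdotC [RHS]hdotC; congr (_^*).
  rewrite hdotDl hdotNl !G_adjE// -adjEr// -S_sym; [|exact: S_dom..].
  by rewrite -EE hdotDr hdotNr; ring.
rewrite !H_SE// (HAadj_change lH mH Dmx) -[RHS]addrA; congr (_ + _).
rewrite /A_S /T_S. rewrite GE xE -!/(At _) AtD//.
have [_ ->] := linopD (linopP S) (S_dom Dmx) (S_dom (ED x)).
rewrite -xE (linear_addl lG) -/(SE x).
move: (At _) (At _) (S _) (SE x) (adj _ _) => p q r t u.
move: (G_adj A m r) (G_adj A m t) => v w.
by apply: hdot_inj => y; rewrite !hdotE; ring.
Qed.

End Comparison.

(** * Krein's resolvent formula *)

Lemma bfG_E z (p : F * Hm1) x : resolvent_set H z ->
  hdot (At (Rz H z^* x)) p.1 + (p.2 (to_H1 H (Rz H z^* x)))^* =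
  hdot x (bfG A z p).
Proof.
move=> zH; have zcH := resolvent_set_conj H_sa zH.
have RD y := Rz_dom y zcH; have [lR _] := Rz_bounded zcH.
have /bounded_linearP[_ [M M0 RM]] := Rz_bounded zcH.
have /bounded_linearP[_ [N N0 AN]] := ARz_bounded zcH.
have /bounded_linearP[_ [L L0 HL]] : bounded_linear (fun x => H (Rz H z^* x)).
  apply: (@relatively_bounded_Rz _ H 1 0 _ _ _ _ _ zcH) => // [k u v|u].
    exact: linop_linear.
  by rewrite mul1r mul0r addr0.
(* The resolvent is bounded into H_1 with its graph norm, so composing [p.2] with it gives a bounded
   functional on F, as Riesz requires. *)
have toR y : nrm (to_H1 H (Rz H z^* y)) <= (M + L) * nrm y.
  have [_ _ h] := nrm_domain (to_H1 H (Rz H z^* y)).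
  rewrite (le_trans h)// to_H1K//; have := RM y; have := HL y; lra.
move: x; apply: (@adjointP _ _ _ _ _ _ _ (fun x => bfA A (to_H1 H (Rz H z^* x)))).
apply: (@riesz _ _ _ (N * nrm p.1 + nrm p.2 * (M + L))) => [k x y|x].
  rewrite /pair_sum/pair_1_m1/= -!/(At _).
  rewrite lR At_linear// to_H1_linear// antidual_linear.
  by rewrite hdotDl hdotZl conjD conjM conjCK; ring.
rewrite /pair_sum/pair_1_m1/= -!/(At _) (le_trans (cnrmD _ _))// cnrmJ mulrDl.
apply: lerD.
  rewrite (le_trans (cauchy_schwarz _ _))// [leRHS]mulrAC.
  by rewrite ler_wpM2r ?nrm_ge0.
by rewrite (le_trans (antidual_bound _ _))// -mulrA ler_wpM2l ?nrm_ge0.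
Qed.

(** Second components from F are the relevant ones: [Theta_S] has its domain there and
    [krein_inverse] its values. *)
Lemma bfG_to_Hm1 z x y : resolvent_set H z ->
  bfG A z (x, to_Hm1 H y) = Gz A z x + Rz H z y.
Proof.
move=> zH; have zcH := resolvent_set_conj H_sa zH.
apply: hdot_inj => v; rewrite -bfG_E//= to_Hm1E to_H1K; last exact: Rz_dom.
by rewrite -hdotC GzE// Rz_adjr// hdotDr.
Qed.

Lemma bfG_adjE z x : resolvent_set H z ->
  bfG_adj A z^* x = (At (Rz H z x), to_H1 H (Rz H z x)).
Proof.
move=> zH; have zcH := resolvent_set_conj H_sa zH.
apply: adjoint_unique => [p|[u1 u2] uP].
  rewrite hdotC -bfG_E// conjCK /pair_sum/pair_m1_1/=.
  by rewrite conjD conjCK -hdotC.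
have := uP (_, 0); rewrite /pair_sum/pair_m1_1/= => u1P.
congr pair; first by apply: hdot_inj => v; apply: (addIr 0); exact: (u1P v).
apply: dval_inj; apply: hdot_inj => v.
have := uP (0, to_Hm1 H v); rewrite /pair_sum/pair_m1_1/= !hdot0l !add0r.
by rewrite !to_Hm1E.
Qed.

Section Krein.
Variable l : R.
Hypothesis lH : resolvent_set H l%:C.
Variable z : C.
Hypothesis zH : resolvent_set H z.
Hypothesis zS : resolvent_set (H_S S A l) z.
Local Notation G := (Gz A l%:C).

Lemma G_adj_At x : G_adj A l x = At (Rz H l%:C x).
Proof.
apply: adj_unique => y; rewrite GzEl//.
by rewrite conj_real_complex.
Qed.

Lemma domD_z x : domD A l x -> pdom H (x - Gz A z x).
Proof. exact: domD_change. Qed.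

(** For [w = x - G_z x - R_z y], the vector fed to [A] in [bfM] is [w - (x - G x) + R y]. As
    [A R = G^*], the terms [G^* y] and [R y] cancel against [Theta_S], and the second component is
    [w] alone, so the system can be solved by elimination. *)
Lemma Theta_ME x y : domD A l x ->
  Theta_M S A l z (x, to_Hm1 H y) =
  (T_S S A l x + y - At (x - G x) + At (x - Gz A z x - Rz H z y),
   to_H1 H (x - Gz A z x - Rz H z y)).
Proof.
move=> Dx; rewrite /Theta_M/= /bfM !bfG_to_Hm1// to_Hm1K//.
have Dz := domD_z Dx; have Rl := Rz_dom y lH; have Rzy := Rz_dom y zH.
have -> : G x + Rz H l%:C y - (Gz A z x + Rz H z y) =
    (x - Gz A z x - Rz H z y) - (x - G x) + Rz H l%:C y.
  by apply: hdot_inj => v; rewrite !hdotE; ring.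
set w := x - Gz A z x - Rz H z y.
have Dw : pdom H w by exact: pdomB.
rewrite /bfA -/(At _) [At (_ - _ + _)]AtD//; last exact: pdomB.
rewrite (AtB Dw Dx) -(G_adj_At y); congr pair; last first.
  apply: dval_inj; rewrite dvalD dvalB !to_H1K//; last first.
    by apply: pdomD => //; exact: pdomB.
  by apply: hdot_inj => v; rewrite !hdotE; ring.
move: (T_S _ _ _ _) (At _) (At _) (G_adj _ _ _) => t p q r.
by apply: hdot_inj => v; rewrite /= !hdotE; ring.
Qed.

(** The second row forces [y = (-H + z) (x - G_z x - g)]. Inserted into the first row, it turns that
    row into [(-H_S + z) x = f + (-H + z) g - A g], the right-hand side being this source. *)
Definition krein_source (p : F * H1) : F :=
  p.1 + (- H (dval p.2) + z *: dval p.2) - A p.2.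

(** The second component is written with [Hbar] and [A_adj] so that each term is visibly bounded
    into H_{-1}. [krein_charge] is the same element as a vector of F, where the unbounded [H] hides
    the boundedness. *)
Definition krein_inverse (p : F * H1) : F * Hm1 :=
  let x := resolvent (H_S S A l) z (krein_source p) in
  (x, to_Hm1 H (z *: x + H (dval p.2) - z *: dval p.2) -
      (Hbar H x + A_adj A x)).

Definition krein_charge (p : F * H1) : F :=
  let x := resolvent (H_S S A l) z (krein_source p) in
  let w := x - Gz A z x - dval p.2 in - H w + z *: w.

Lemma krein_inverseE p : krein_inverse p =
  (resolvent (H_S S A l) z (krein_source p), to_Hm1 H (krein_charge p)).
Proof.
rewrite /krein_inverse /krein_charge.
set x := resolvent _ _ _.
have Dz : pdom H (x - Gz A z x) by apply: domD_z; exact: (resolvent_dom _ zS).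
congr pair; rewrite -(HAadjE zH Dz) -to_Hm1B; congr to_Hm1.
rewrite /HAadj (linop_B Dz (pdom_dval p.2)).
move: (H _) (H _) => h k; apply: hdot_inj => v; rewrite !hdotE; ring.
Qed.

Lemma nrm_pair (U V : normedModType C) (p : U * V) :
  [/\ nrm p.1 <= nrm p, nrm p.2 <= nrm p & nrm p <= nrm p.1 + nrm p.2].
Proof.
have E : nrm p = Num.max (nrm p.1) (nrm p.2).
  apply: (@complexI R); rewrite -nrmE prod_normE !nrmE.
  by have [h|h] := leP (nrm p.1) (nrm p.2);
    [rewrite max_r// lecR|rewrite max_l// lecR ltW].
rewrite E; split; [by rewrite le_max lexx|by rewrite le_max lexx orbT|].
by rewrite ge_max lerDl lerDr !nrm_ge0.
Qed.

Lemma krein_inverse_bounded : bounded_linear krein_inverse.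
Proof.
have bfst : bounded_linear (fun p : F * H1 => p.1).
  apply/bounded_linearP; split=> //; exists 1 => // p; rewrite mul1r.
  by have [] := nrm_pair p.
have bsnd : bounded_linear (fun p : F * H1 => p.2).
  apply/bounded_linearP; split=> //; exists 1 => // p; rewrite mul1r.
  by have [] := nrm_pair p.
have bd : bounded_linear (fun y : H1 => dval y).
  apply/bounded_linearP; split=> [k x y|]; first by rewrite dvalD dvalZ.
  by exists 1 => // y; rewrite mul1r; have [] := nrm_domain y.
have bH : bounded_linear (fun y : H1 => H (dval y)).
  apply/bounded_linearP; split=> [k x y|].
    by rewrite dvalD dvalZ linop_linear//; exact: pdom_dval.
  by exists 1 => // y; rewrite mul1r; have [] := nrm_domain y.
have bA : bounded_linear A.
  apply/bounded_linearP; split; first exact: linearP.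
  by exists (a + b); [exact: addr_ge0|exact: A_bounded_H1].
have bd2 := bounded_comp bd bsnd; have bH2 := bounded_comp bH bsnd.
have bx : bounded_linear (fun p => resolvent (H_S S A l) z (krein_source p)).
  apply: (bounded_comp (resolvent_bounded zS)).
  apply: bounded_sub; last exact: bounded_comp bA bsnd.
  apply: bounded_add => //; apply: bounded_add; first exact: bounded_opp.
  exact: bounded_scale.
have by2 : bounded_linear (fun p => (krein_inverse p).2).
  apply: bounded_sub.
    apply: (bounded_comp (@to_Hm1_bounded _ _ H)).
    apply: bounded_sub; last exact: bounded_scale.
    by apply: bounded_add => //; exact: bounded_scale.
  apply: bounded_add; first exact: (bounded_comp (Hbar_bounded dH sH)).
  exact: (bounded_comp (A_adj_bounded (addr_ge0 a0 b0) A_bounded_H1)).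
have /bounded_linearP[lx [M M0 xM]] := bx.
have /bounded_linearP[ly [N N0 yN]] := by2.
apply/bounded_linearP; split=> [k p q|].
  rewrite [LHS]surjective_pairing [X in (_, X)]ly [X in (X, _)]lx.
  by [].
exists (M + N) => [|p]; first exact: addr_ge0.
have [_ _ h] := nrm_pair (krein_inverse p).
by rewrite (le_trans h)// mulrDl; apply: lerD; [exact: xM|exact: yN].
Qed.

Lemma krein_bounded_inverse : bounded_inverse (Theta_M S A l z) krein_inverse.
Proof.
split; first exact: krein_inverse_bounded.
- move=> [f g]; rewrite krein_inverseE.
  set x := resolvent _ _ _; set y := krein_charge _.
  have Dx : domD A l x := resolvent_dom _ zS.
  have Dz := domD_z Dx; have Dg := pdom_dval g.
  split; first by split=> //; exists y.
  have Ry : Rz H z y = x - Gz A z x - dval g by apply: RzK => //; exact: pdomB.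
  have Ew : x - Gz A z x - (x - Gz A z x - dval g) = dval g.
    by rewrite opprB addrC subrK.
  rewrite Theta_ME// Ry Ew dvalK AtE; congr pair.
  have Ex : H_S S A l x = z *: x - krein_source (f, g) by exact: resolvent_app.
  have : krein_source (f, g) = z *: x - H_S S A l x by rewrite Ex opprB addrC subrK.
  rewrite H_SE// -(HAadj_change zH lH Dx) /HAadj /A_S -/(At _) {1}/krein_source/=.
  rewrite /y /krein_charge -/x (linop_B Dz Dg).
  move: (At _) (T_S _ _ _ _) (H _) (H _) (A _) => p t h k r E.
  have -> : f = z *: x - (k + z *: Gz A z x + (p - t)) - (- h + z *: dval g) + r.
    by rewrite -E; apply: hdot_inj => v; rewrite !hdotE; ring.
  by apply: hdot_inj => v; rewrite !hdotE; ring.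
- move=> [x m] [Dx' [y _ ym]]; have {Dx'}Dx : domD A l x := Dx'.
  rewrite -[m]ym {ym}.
  have Dz := domD_z Dx; have Ryz := Rz_dom y zH.
  have Dw : pdom H (x - Gz A z x - Rz H z y) by exact: pdomB.
  rewrite Theta_ME//; set p : F * H1 := (_, _).
  rewrite krein_inverseE.
  (* The charge [y] drops out, since [(-H + z) R_z y = y], and so does [A] applied to the second
     component. *)
  have Ep : krein_source p = - H_S S A l x + z *: x.
    rewrite H_SE// -(HAadj_change zH lH Dx) /HAadj /A_S -/(At _).
    rewrite /krein_source/= to_H1K// -/(At _).
    rewrite (linop_B Dz Ryz) HRz//.
    move: (At _) (At _) (T_S _ _ _ _) (H _) => q t h k.
    by apply: hdot_inj => v; rewrite !hdotE; ring.
  rewrite Ep; have Ex := resolventK zS Dx; rewrite Ex; congr pair.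
  congr to_Hm1; rewrite /krein_charge Ep Ex /p/= to_H1K//.
  have Ew : x - Gz A z x - (x - Gz A z x - Rz H z y) = Rz H z y.
    by rewrite opprB addrC subrK.
  by rewrite Ew HRz// opprB subrK.
Qed.

(** The source of [(A R_z x, R_z x)] is [x] itself. With [u] the resolvent at [x], applying [bfG] to
    the inverse gives [G_z u + (u - G_z u - R_z x) = u - R_z x]. *)
Lemma krein_formula x : resolvent (H_S S A l) z x =
  Rz H z x + bfG A z (krein_inverse (bfG_adj A z^* x)).
Proof.
rewrite bfG_adjE// krein_inverseE.
have Es : krein_source (At (Rz H z x), to_H1 H (Rz H z x)) = x.
  rewrite /krein_source/= to_H1K ?HRz//; last exact: Rz_dom.
  by rewrite -/(At _); apply: hdot_inj => v; rewrite !hdotE; ring.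
rewrite bfG_to_Hm1// /krein_charge Es/=.
set u := resolvent _ _ _.
have Dz : pdom H (u - Gz A z u) by apply: domD_z; exact: (resolvent_dom _ zS).
rewrite RzK//; last by rewrite to_H1K; [apply: pdomB => //|]; exact: Rz_dom.
rewrite to_H1K; last exact: Rz_dom.
by apply: hdot_inj => v; rewrite !hdotE; ring.
Qed.

End Krein.
End WeylFunction.

(** * Choice of the low energy and conclusion *)

Lemma lt_inf_spectrum_resolvent (R : realType) (F : hilbertType R[i])
    (T : pop F F) (l : R) :
  (l%:E < inf_spectrum T)%E -> resolvent_set T l%:C.
Proof.
move=> lT; apply: contrapT => nl; move: lT; apply/negP; rewrite -leNgt.
by apply: ereal_inf_lbound; exists l.
Qed.

Theorem theorem3p1 (R : realType) (F : hilbertType R[i]) (H S : linop F F)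
    (A : {linear domain_space H -> F}) (lambda0 : R)
    (H_sa : self_adjoint H) (H_bounded_below : bounded_below H)
    (S_symmetric : symmetric_op S) (S_small : small_wrt H S)
    (A_bounded : exists s : R, [/\ 0 < s, s < 1 & bounded_on_Hs A s])
    (ran_G : forall z : R[i], resolvent_set H z ->
      range (Gz A z) `&` pdom H = [set 0])
    (lambda0_lt : (lambda0%:E < inf_spectrum H)%E) :
  [/\ forall x : F, domD A lambda0 x ->
        range (@to_Hm1 R F H) (Hbar H x + A_adj A x),
      self_adjoint (H_S S A lambda0),
      bounded_below (H_S S A lambda0)
    & forall z : R[i],
        resolvent_set H z -> resolvent_set (H_S S A lambda0) z ->
        exists2 L : F * domain_space H -> F * antidual (domain_space H),
          bounded_inverse (Theta_M S A lambda0 z) L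
        & forall x : F, resolvent (H_S S A lambda0) z x =
            Rz H z x + bfG A z (L (bfG_adj A z^* x))].
Proof.
have [_ dH sH _] := self_adjointP H_sa.
have [c cH] := proj1 (bounded_belowP sH) H_bounded_below.
have lH := lt_inf_spectrum_resolvent lambda0_lt.
have [S_dom [sa [b [sa0 sa1 S_ab]]]] := S_small.
have S_le x : pdom H x -> nrm (S x) <= sa * nrm (H x) + `|b| * nrm x.
  move=> Hx; have := S_ab x Hx; rewrite !nrmE -!real_complexM -real_complexD lecR.
  by have := ler_wpM2r (nrm_ge0 x) (ler_norm b); lra.
have [s [s0 s1 As]] := A_bounded.
have e0 : 0 < 4^-1 :> R by rewrite invr_gt0.
have [K K0 A_le] := bounded_on_Hs_infinitesimal s0 s1 e0 As.
have At_rel x : pdom H x -> nrm (At A x) <= 4^-1 * nrm (H x) + K * nrm x.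
  exact: At_le.
(* [q] lies strictly between [sa] and 1 and is at least 1/2, hence above the relative bound 1/4
   taken for [A]: one constant serves [S] and [A]. *)
pose q := (sa + 1) / 2.
have [q0 q1 saq eq4] : [/\ 0 <= q, q < 1, sa < q & 4^-1 < q].
  by rewrite /q; split; lra.
have [L1 L1c SL] := relatively_bounded_shift cH sa0 saq S_le.
have [L2 L2c AL] := relatively_bounded_shift cH (ltW e0) eq4 At_rel.
pose m := Num.min L1 L2.
have mL1 : m <= L1 by rewrite /m ge_min lexx.
have mL2 : m <= L2 by rewrite /m ge_min lexx orbT.
have mc : m < c by exact: le_lt_trans L1c.
have mH : resolvent_set H m%:C by exact: resolvent_set_below cH mc.
have Sq x : pdom H x -> nrm (S x) <= q * nrm (H x - m%:C *: x) by exact: SL.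
have Aq x : pdom H x -> nrm (At A x) <= q * nrm (H x - m%:C *: x) by exact: AL.
have m_sa : self_adjoint (H_S S A m).
  exact: (H_S_low_self_adjoint H_sa (ltW e0) K0 A_le S_symmetric S_dom mH q1
    Sq Aq).
have m_low := H_S_low_bounded H_sa (ltW e0) K0 A_le S_symmetric S_dom mH
  mc cH q0 q1 Sq.
have [B bB BE] := H_S_comparison H_sa (ltW e0) K0 A_le S_symmetric S_dom sa0
  (normr_ge0 b) S_le lH mH.
have S_sym := H_S_symmetric H_sa (ltW e0) K0 A_le S_symmetric S_dom lH.
have domE : domD A lambda0 = domD A m.
  by apply/seteqP; split=> x Dx;
    [exact: (domD_change H_sa (ltW e0) K0 A_le mH lH)|
     exact: (domD_change H_sa (ltW e0) K0 A_le lH mH)].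
split.
- move=> x Dx; exists (HAadj A lambda0%:C x) => //.
  exact: (HAadjE H_sa (ltW e0) K0 A_le lH Dx).
- exact: (@self_adjoint_add_bounded _ _ (H_S S A lambda0) _ _ m_sa bB domE BE).
- apply/(bounded_belowP S_sym).
  have /bounded_linearP[_ [M M0 BM]] := bB.
  (* [m] bounds the operator at energy [m] from below, and the perturbation [B] costs at most its
     norm bound [M]. *)
  exists (m - M) => x Dx.
  have Dm : domD A m x by rewrite -domE.
  rewrite BE// hdotDl ReD.
  have := m_low x Dm; have := Re_hdot_le (- B x) x; rewrite hdotNl ReN nrmN.
  by have := ler_wpM2r (nrm_ge0 x) (BM x); lra.
- move=> z zH zS; exists (krein_inverse A S lambda0 z).
    exact: (krein_bounded_inverse H_sa (ltW e0) K0 A_le lH zH zS).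
  move=> x; exact: (krein_formula H_sa (ltW e0) K0 A_le lH zH zS).
Qed.
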